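(* For each fixed $d$ there exist a (large) constant $C_0>0$ and a constant $c_d>0$ depending only on $d$ such that the following holds. Let $\boldsymbol p=(p_1,\dots,p_d)$, $\boldsymbol r=(r_1,\dots,r_{d-1})$, $\boldsymbol\lambda=(\lambda_1,\dots,\lambda_{d-1})$ and $\sigma>0$, and consider the model $\boldsymbol{\mathcal Y}=\boldsymbol{\mathcal X}+\boldsymbol{\mathcal Z}$. Assume $p=\min\{p_1,\dots,p_d\}\ge C_0$, $r_1\le p_1/2$, $r_i\le p_ir_{i-1}/2$ and $r_{i-1}\le p_ir_i/2$ for $2\le i\le d-1$, $r_{d-1}\le p_d$, and $\lambda_i>0$ for all $i$. Also assume $r_1r_2\le p_1$ if $d=3$. Then $$\inf_{\widehat{\boldsymbol{\mathcal X}}}\ \sup_{\boldsymbol{\mathcal X}\in\mathcal F_{\boldsymbol p,\boldsymbol r}(\boldsymbol\lambda),\,D\in\mathcal D}\mathbb{E}_{\boldsymbol{\mathcal Z}\sim D}\bigl\|\widehat{\boldsymbol{\mathcal X}}-\boldsymbol{\mathcal X}\bigr\|_{\mathrm F}^2\ \ge\ c_d\,\sigma^2\sum_{i=1}^dp_ir_ir_{i-1},$$ where the infimum is over all estimators $\widehat{\boldsymbol{\mathcal X}}=\widehat{\boldsymbol{\mathcal X}}(\boldsymbol{\mathcal Y})$, i.e. measurable functions of the observation $\boldsymbol{\mathcal Y}=\boldsymbol{\mathcal X}+\boldsymbol{\mathcal Z}$.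
   Context: $d\ge2$, $p_k$ and $r_k$ are positive integers, $r_0=r_d=1$; $\|\cdot\|_{\mathrm F}$ is the entrywise Frobenius norm and $s_j(A)$ is the $j$th largest singular value of a matrix $A$. A random variable $z$ is $\sigma$-sub-Gaussian if $\mathbb{E}e^{t(z-\mathbb{E}z)}\le e^{\sigma^2t^2/2}$ for all $t\in\mathbb{R}$. The sequential unfolding $[\boldsymbol{\mathcal X}]_k\in\mathbb{R}^{(p_1\cdots p_k)\times(p_{k+1}\cdots p_d)}$ of $\boldsymbol{\mathcal X}\in\mathbb{R}^{p_1\times\cdots\times p_d}$ has entry $\boldsymbol{\mathcal X}_{i_1,\dots,i_d}$ at row $i_1+(i_2-1)p_1+\cdots+(i_k-1)p_1\cdots p_{k-1}$ and column $i_{k+1}+(i_{k+2}-1)p_{k+1}+\cdots+(i_d-1)p_{k+1}\cdots p_{d-1}$. $\boldsymbol{\mathcal X}$ admits a tensor-train (TT) decomposition with ranks $(r_1,\dots,r_{d-1})$ if there are $G_1\in\mathbb{R}^{p_1\times r_1}$, $\boldsymbol{\mathcal G}_k\in\mathbb{R}^{r_{k-1}\times p_k\times r_k}$ ($2\le k\le d-1$), $G_d\in\mathbb{R}^{p_d\times r_{d-1}}$ with $\boldsymbol{\mathcal X}_{i_1,\dots,i_d}=\sum_{\alpha_1=1}^{r_1}\cdots\sum_{\alpha_{d-1}=1}^{r_{d-1}}G_{1,[i_1,\alpha_1]}\boldsymbol{\mathcal G}_{2,[\alpha_1,i_2,\alpha_2]}\cdots\boldsymbol{\mathcal G}_{d-1,[\alpha_{d-2},i_{d-1},\alpha_{d-1}]}G_{d,[i_d,\alpha_{d-1}]}$.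 $\mathcal F_{\boldsymbol p,\boldsymbol r}(\boldsymbol\lambda)$ is the set of $\boldsymbol{\mathcal X}\in\mathbb{R}^{p_1\times\cdots\times p_d}$ that admit a TT decomposition with ranks $(r_1,\dots,r_{d-1})$ and satisfy $s_{r_k}([\boldsymbol{\mathcal X}]_k)\ge\lambda_k$ for $1\le k\le d-1$. $\mathcal D$ is the set of distributions $D$ on $\mathbb{R}^{p_1\times\cdots\times p_d}$ such that if $\boldsymbol{\mathcal Z}\sim D$, then the entries $\boldsymbol{\mathcal Z}_{i_1,\dots,i_d}$ are independent, mean-zero, $\sigma$-sub-Gaussian random variables. *)

(* Defs.v *)
From HB Require Import structures.
From mathcomp Require Import all_boot all_order all_algebra.
From mathcomp Require Import all_classical all_reals all_analysis.

Set Implicit Arguments.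
Unset Strict Implicit.
Unset Printing Implicit Defensive.

Import Order.TTheory GRing.Theory Num.Theory.
Import numFieldNormedType.Exports.

Local Open Scope classical_set_scope.
Local Open Scope ring_scope.

(* The dimensions p_1, ..., p_d, the ranks r_0, ..., r_d and the levels
   lambda_1, ..., lambda_{d-1} are functions on nat with these 1-based indices;
   their values outside these ranges are never used. The position k : 'I_d of a
   multi-index is 0-based, so it has range 'I_(p k.+1). *)
Definition tidx (d : nat) (p : nat -> nat) : finType :=
  {dffun forall k : 'I_d, 'I_(p k.+1)}.

Definition tensor (R : realType) (d : nat) (p : nat -> nat) : Type :=
  {ffun tidx d p -> R}.

Section tensor_instances.
Context (R : realType) (d : nat) (p : nat -> nat).
Local Notation T := (tensor R d p).

HB.instance Definition _ := GRing.Zmodule.on T.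
HB.instance Definition _ := isPointed.Build T 0.

(* The sets (fun X => X i) @^-1` B, with B Borel, generate the Borel sets of
   the finite-dimensional space of tensors. *)
Definition tensor_cylinders : set (set T) :=
  [set A | exists (i : tidx d p) (B : set R),
     measurable B /\ A = [set X : T | B (X i)]].

Let tensor_measurable0 : <<s tensor_cylinders >> set0.
Proof. exact: sigma_algebra0. Qed.

Let tensor_measurableC (A : set T) :
  <<s tensor_cylinders >> A -> <<s tensor_cylinders >> (~` A).
Proof. exact: sigma_algebraC. Qed.

Let tensor_measurable_bigcup (F : (set T)^nat) :
  (forall i, <<s tensor_cylinders >> (F i)) ->
  <<s tensor_cylinders >> (\bigcup_i F i).
Proof. exact: sigma_algebra_bigcup. Qed.

HB.instance Definition _ := @isMeasurable.Build (sigma_display tensor_cylinders)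
  T <<s tensor_cylinders >>
  tensor_measurable0 tensor_measurableC tensor_measurable_bigcup.

End tensor_instances.

Section tensor_train.
Context (R : realType) (d : nat) (p : nat -> nat).

Definition frobenius_norm (X : tensor R d p) : R :=
  Num.sqrt (\sum_(i : tidx d p) X i ^+ 2).

(* Sequential unfolding. With 0-based entries i_j, the row of i is
   i_1 + i_2 p_1 + ... + i_k p_1 ... p_{k-1}. *)
Definition unfold_row (k : nat) (i : tidx d p) : nat :=
  (\sum_(j < d | j < k) i j * \prod_(1 <= l < j.+1) p l)%N.

Definition unfold_col (k : nat) (i : tidx d p) : nat :=
  (\sum_(j < d | k <= j) i j * \prod_(k.+1 <= l < j.+1) p l)%N.

(* By uniqueness of mixed-radix expansions the sum has exactly one term: the
   entry X i sits at row [unfold_row k i] and column [unfold_col k i]. *)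
Definition unfolding (k : nat) (X : tensor R d p) :
    'M[R]_((\prod_(1 <= l < k.+1) p l)%N, (\prod_(k.+1 <= l < d.+1) p l)%N) :=
  \matrix_(a, b)
    \sum_(i : tidx d p | (unfold_row k i == a) && (unfold_col k i == b)) X i.

(* All cores are r_{k-1} x p_k x r_k arrays; since this is used with
   r_0 = r_d = 1, the first and last cores are matrices and the summation
   indices alpha_0 and alpha_d take a single value. The bond index at position
   [lift ord0 k] is alpha_{k+1}. *)
Definition has_TT (r : nat -> nat) (X : tensor R d p) : Prop :=
  exists G : forall k : 'I_d, 'I_(r k) -> 'I_(p k.+1) -> 'I_(r k.+1) -> R,
  forall i : tidx d p,
    X i = \sum_(alpha : {dffun forall k : 'I_d.+1, 'I_(r k)})
            \prod_(k < d)
               G k (alpha (widen_ord (leqnSn d) k)) (i k) (alpha (lift ord0 k)).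

End tensor_train.

Section singular_values.
Context (R : realType) (m n : nat).

(* Nonnegative square roots of the eigenvalues of A^T A, with multiplicity,
   in nonincreasing order. *)
Definition singular_value_seq (A : 'M[R]_(m, n)) (s : seq R) : Prop :=
  [/\ sorted >=%R s, all (fun x => 0 <= x) s &
      char_poly (A^T *m A) = \prod_(x <- s) ('X - (x ^+ 2)%:P)].

(* The j-th largest singular value, for 1 <= j; such a sequence exists and is
   unique because A^T A is symmetric positive semidefinite. *)
Definition singular_value (j : nat) (A : 'M[R]_(m, n)) : R :=
  nth 0 (xget [::] [set s | singular_value_seq A s]) j.-1.

End singular_values.

Definition TT_class (R : realType) (d : nat) (p r : nat -> nat)
    (lambda : nat -> R) : set (tensor R d p) :=
  [set X | has_TT r X /\
     forall k : nat, (1 <= k <= d.-1)%N ->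
       lambda k <= singular_value (r k) (unfolding k X)].

Section noise.
Context (disp : measure_display) (Omega : measurableType disp) (R : realType).

Definition sub_gaussian (P : probability Omega R) (sigma : R) (z : Omega -> R) :
    Prop :=
  forall t : R,
    ('E_P[fun w => expR (t * (z w - fine ('E_P[z])%E))]
       <= (expR (sigma ^+ 2 * t ^+ 2 / 2))%:E)%E.

Definition mutually_independent (P : probability Omega R) (I : finType)
    (z : I -> Omega -> R) : Prop :=
  forall (J : {set I}) (B : I -> set R), (forall i, measurable (B i)) ->
    (P (\bigcap_(i in [set i | i \in J]) z i @^-1` B i)
       = \prod_(i in J) P (z i @^-1` B i))%E.

End noise.

Definition noise_class (R : realType) (d : nat) (p : nat -> nat) (sigma : R) :
    set (probability (tensor R d p) R) :=
  [set D | let entry (i : tidx d p) (Z : tensor R d p) : R := Z i in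
     [/\ mutually_independent D entry,
         forall i, ('E_D[entry i] = 0)%E &
         forall i, sub_gaussian D sigma (entry i)]].

Definition squared_error (R : realType) (d : nat) (p : nat -> nat)
    (Xhat : tensor R d p -> tensor R d p) (X Z : tensor R d p) : R :=
  frobenius_norm (Xhat (X + Z) - X) ^+ 2.

Definition minimax_risk (R : realType) (d : nat) (p r : nat -> nat)
    (lambda : nat -> R) (sigma : R) : \bar R :=
  ereal_inf
    [set ereal_sup
       [set ('E_D[squared_error Xhat X])%E
         | X in @TT_class R d p r lambda & D in @noise_class R d p sigma]
    | Xhat in [set f : tensor R d p -> tensor R d p | measurable_fun setT f]].

(* Main.v *)
Require Import Defs.
From HB Require Import structures.
From mathcomp Require Import all_boot all_order all_algebra.
From mathcomp Require Import sesquilinear spectral complex.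
From mathcomp Require Import all_classical all_reals all_analysis measurable_realfun.
From mathcomp Require Import zify ring lra.

(** The right-hand side has d terms, one per core, so up to the constant 1/d it
    suffices to bound the risk from below by sigma^2 p_k r_k r_{k-1} for each
    core k. For the last core this may fail to be possible directly, but then
    its term is dominated by that of the previous core.

    Fix a core. The lower bound comes from Assouad's method on a family of
    tensors obtained by freezing the other cores and letting at least a third of
    the entries of the chosen core be arbitrary signs, up to scale. Three things
    are needed.

    - Membership in the class. The frozen cores are supported on transitions
      between bond states given by Euclidean division (b = j r + a or
      a = j r' + b). An index of the tensor then determines the bond states from
      the left end as well as from the right end. The slices of the chosen core
      that contain no free sign carry the same pattern multiplied by some
      M >= lambda_1, ..., lambda_{d-1}, so that each sequential unfolding
      contains an r_k by r_k diagonal submatrix with diagonal entries at least M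
      ([signed_tensor_sv]). This forces s_{r_k} >= M for all choices of signs
      ([singular_value_ge]).

    - Signs that are hard to see. A free sign inevitably occurs in several
      entries of the tensor when the ranks decrease towards the chosen core. The
      frozen cores are weighted so that one entry gets the weight
      H = h^(d - 1) and all the other occurrences together at most H
      ([response_main], [response_sum]).

    - A noise that hides them. All entries are uniform on a fine lattice of
      amplitude sigma / 2, and every sign moves the signal by lattice points.
      Flipping a sign can thus be compensated exactly by a shift of the noise,
      for at least half of the noise vectors ([card_shiftable]); on these the
      estimator cannot tell the two signs apart ([assouad]). Working with a
      finite noise turns the whole argument into counting. *)

Set Implicit Arguments.
Unset Strict Implicit.
Unset Printing Implicit Defensive.

Import Order.TTheory GRing.Theory Num.Theory.
Local Open Scope ring_scope.

(** * Singular values and diagonal submatrices *)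

Lemma wide_kernel (K : fieldType) k r (N : 'M[K]_(k, r)) :
  (k < r)%N -> exists2 x : 'cV[K]_r, x != 0 & N *m x = 0.
Proof.
move=> kr; have : kermx N^T != 0.
  rewrite kermx_eq0 /row_free; apply/eqP => rk.
  by move: (rank_leq_col N^T); rewrite rk leqNgt kr.
case/rowV0Pn => v /sub_kermxP vN v0; exists v^T.
  by rewrite -trmx0 (inj_eq trmx_inj).
by apply: trmx_inj; rewrite trmx_mul trmxK vN trmx0.
Qed.

Section GramSpectrum.
Local Open Scope sesquilinear_scope.

Lemma sqnormmxE (C : numClosedFieldType) k (v : 'cV[C]_k) :
  (v^t* *m v) 0 0 = \sum_a `|v a 0| ^+ 2.
Proof.
rewrite mxE; apply: eq_bigr => a _.
by rewrite !mxE mulrC -normCK.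
Qed.

Variables (C : numClosedFieldType) (m n : nat) (B : 'M[C]_(m, n)).

Lemma gram_spectral :
  exists (P : 'M[C]_n) (D : 'rV[C]_n), [/\ P \is unitarymx,
    forall i, 0 <= D 0 i & B^t* *m B = P^t* *m diag_mx D *m P].
Proof.
pose S := B^t* *m B; pose P := spectralmx S.
have Pu : P \is unitarymx by exact: spectral_unitarymx.
have Sn : S \is normalmx.
  by apply/normalmxP; rewrite /S trmx_mul map_mxM trmxCK.
have := orthomx_spectralP Sn; rewrite -/P invmx_unitary //.
set D := spectral_diag S => SE.
exists P, D; split => // i.
have DE : diag_mx D = (B *m P^t*)^t* *m (B *m P^t*).
  rewrite trmx_mul map_mxM trmxCK mulmxA -(mulmxA P) -/S SE !mulmxA.
  by rewrite (unitarymxP Pu) mul1mx -mulmxA (unitarymxP Pu) mulmx1.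
have -> : D 0 i = diag_mx D i i by rewrite mxE eqxx.
set F := B *m P^t* in DE *.
rewrite DE mxE sumr_ge0 // => a _.
by rewrite !mxE mulrC -normCK exprn_ge0.
Qed.

(** If B contains an r by r diagonal submatrix (rows [a s], columns [b s])
    whose entries have modulus at least M, the Gram matrix has at most n - r
    eigenvalues below M^2. Otherwise the span of the eigenvectors of those small
    eigenvalues would meet the span of the r coordinate vectors [b s] in a
    nonzero v; then |B v|^2 < M^2 |v|^2 by the first membership and
    |B v|^2 >= M^2 |v|^2 by the second. *)
Lemma gram_small_eigen r (M : C) (a : 'I_r -> 'I_m) (b : 'I_r -> 'I_n)
    (P : 'M[C]_n) (D : 'rV[C]_n) :
  0 < M -> P \is unitarymx -> (forall i, 0 <= D 0 i) ->
  B^t* *m B = P^t* *m diag_mx D *m P ->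
  (forall s, M <= `|B (a s) (b s)|) ->
  (forall s t, s != t -> B (a s) (b t) = 0) ->
  (#|[set i | (D 0 i < M ^+ 2)%R]| + r <= n)%N.
Proof.
move=> M0 Pu D0 SE Bd B0; rewrite leqNgt; apply/negP => lt.
pose I := [set i | (D 0 i < M ^+ 2)%R].
have PP : P^t* *m P = 1%:M.
  have: P^t* \is unitarymx by rewrite trmxC_unitary.
  by move/unitarymxP; rewrite trmxCK.
have cI : (#|I| + #|~: I| = n)%N by rewrite cardsC card_ord.
have kr : (#|~: I| < r)%N by rewrite -/I in lt; lia.
have binj s t : b s = b t -> s = t.
  move=> e; apply/eqP/negPn/negP => /B0 z.
  by have := Bd s; rewrite e z normr0 real_leNgt ?M0 // gtr0_real.
have ainj s t : a s = a t -> s = t.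
  move=> e; apply/eqP/negPn/negP => /B0 z.
  by have := Bd t; rewrite -e z normr0 real_leNgt ?M0 // gtr0_real.
pose E : 'M[C]_(n, r) := \matrix_(t, s) (t == b s)%:R.
pose N : 'M[C]_(#|~: I|, r) := \matrix_(i, s) (P *m E) (enum_val i) s.
(* A vector supported on the columns b s that has no component along the
   eigenvectors of large eigenvalues: fewer than r equations on r unknowns. *)
have [x x0 Nx] := wide_kernel N kr.
pose v := E *m x; pose c := P *m v.
have vE t : v t 0 = \sum_s (t == b s)%:R * x s 0.
  by rewrite mxE; apply: eq_bigr => s _; rewrite mxE.
have vb s : v (b s) 0 = x s 0.
  rewrite vE (bigD1 s) //= eqxx mul1r big1 ?addr0 // => t ts.
  by case: eqP => [/binj e|]; rewrite ?mul0r //; rewrite e eqxx in ts.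
have ci i : i \notin I -> c i 0 = 0.
  move=> iI; have iC : i \in ~: I by rewrite inE.
  have := congr1 (fun A : 'cV__ => A (enum_rank_in iC i) 0) Nx.
  rewrite /c /v mulmxA [RHS]mxE => <-; rewrite !mxE; apply: eq_bigr => s _.
  by rewrite [N _ _]mxE enum_rankK_in.
have nx : 0 < \sum_s `|x s 0| ^+ 2.
  have [s xs] : exists s, x s 0 != 0.
    apply/existsP; apply: contraNT x0; rewrite negb_exists => /forallP h.
    by apply/eqP/matrixP => s j; rewrite ord1 !mxE; apply/eqP/negPn/h.
  rewrite (bigD1 s) //= ltr_pwDl ?exprn_gt0 ?normr_gt0 //.
  by rewrite sumr_ge0 // => t _; rewrite exprn_ge0.
have sqv : \sum_t `|v t 0| ^+ 2 = \sum_i `|c i 0| ^+ 2.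
  rewrite -!sqnormmxE /c [in RHS]trmx_mul [in RHS]map_mxM.
  by rewrite [in RHS]mulmxA -(mulmxA _ _ P) PP mulmx1.
have xv : \sum_t `|v t 0| ^+ 2 = \sum_s `|x s 0| ^+ 2.
  rewrite (bigID (mem [set b s | s in 'I_r])) /= [X in _ + X]big1 ?addr0.
    rewrite big_imset /=; last by move=> s t _ _; apply: binj.
    by apply: eq_big => // s _; rewrite vb.
  move=> t tn; rewrite vE big1 ?normr0 ?expr0n // => s _.
  by case: eqP => [e|]; rewrite ?mul0r //; rewrite e imset_f in tn.
have BvE s : (B *m v) (a s) 0 = B (a s) (b s) * x s 0.
  rewrite mxE (bigID (mem [set b t | t in 'I_r])) /= [X in _ + X]big1 ?addr0.
    rewrite big_imset /=; last by move=> s1 t _ _; apply: binj.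
    rewrite (bigD1 s) //= vb big1 ?addr0 // => t ts.
    by rewrite B0 ?mul0r // eq_sym.
  move=> t tn; rewrite vE big1 ?mulr0 // => t' _.
  by case: eqP => [e|]; rewrite ?mul0r //; rewrite e imset_f in tn.
have low : M ^+ 2 * \sum_s `|x s 0| ^+ 2 <= \sum_i `|(B *m v) i 0| ^+ 2.
  rewrite [leRHS](bigID (mem [set a s | s in 'I_r])) /=.
  rewrite big_imset /=; last by move=> s1 t _ _; apply: ainj.
  apply: (@le_trans _ _ (\sum_s `|(B *m v) (a s) 0| ^+ 2)).
    rewrite mulr_sumr; apply: ler_sum => s _.
    rewrite BvE normrM exprMn ler_wpM2r ?exprn_ge0 //.
    by rewrite lerXn2r ?nnegrE ?(ltW M0) ?normr_ge0 ?Bd.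
  by rewrite lerDl sumr_ge0 // => t _; rewrite exprn_ge0.
have upE : \sum_i `|(B *m v) i 0| ^+ 2 = \sum_i D 0 i * `|c i 0| ^+ 2.
  rewrite -sqnormmxE trmx_mul map_mxM mulmxA -(mulmxA _ _ B) SE.
  rewrite -!mulmxA -/c 2!mulmxA -map_mxM -trmx_mul -/c -mulmxA mxE.
  apply: eq_bigr => i _; rewrite mul_diag_mx [X in _ * X]mxE.
  by rewrite [(c^t*) _ _]mxE [c^T _ _]mxE mulrCA mulrC normCK mulrC (mulrC (c i 0)).
have : \sum_i D 0 i * `|c i 0| ^+ 2 < M ^+ 2 * \sum_i `|c i 0| ^+ 2.
  have [i c0] : exists i, c i 0 != 0.
    apply/existsP; apply: contraT; rewrite negb_exists => /forallP h.
    move: nx; rewrite -xv sqv big1 ?ltxx // => i _.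
    by have := h i; rewrite negbK => /eqP->; rewrite normr0 expr0n.
  rewrite mulr_sumr (bigD1 i) //= [X in _ < X](bigD1 i) //=.
  have iI : i \in I by apply: contraNT c0 => /ci->.
  rewrite ltr_leD //.
    by rewrite ltr_pM2r ?exprn_gt0 ?normr_gt0 //; rewrite inE in iI.
  apply: ler_sum => j _; case: (boolP (j \in I)) => [|/ci->]; last first.
    by rewrite normr0 expr0n !mulr0.
  by rewrite inE => jI; rewrite ler_wpM2r ?exprn_ge0 // ltW.
rewrite -upE -sqv xv => lt2.
by have := le_lt_trans low lt2; rewrite ltxx.
Qed.

End GramSpectrum.

Lemma char_poly_similar (F : comUnitRingType) n (P D : 'M[F]_n) :
  P \in unitmx -> char_poly (invmx P *m D *m P) = char_poly D.
Proof.
move=> Pu; rewrite /char_poly /char_poly_mx.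
pose Q := map_mx polyC P; pose Q' := map_mx polyC (invmx P).
have Q'Q : Q' *m Q = 1%:M by rewrite -map_mxM mulVmx // map_mx1.
have -> : 'X%:M - map_mx polyC (invmx P *m D *m P)
        = Q' *m ('X%:M - map_mx polyC D) *m Q.
  rewrite mulmxBr mulmxBl !map_mxM -/Q -/Q'; congr (_ - _).
  by rewrite mul_mx_scalar -scalemxAl Q'Q scalemx1.
by rewrite !det_mulmx mulrAC -det_mulmx Q'Q det1 mul1r.
Qed.

Section SingularValue.
Local Open Scope sesquilinear_scope.
Variables (R : realType) (m n : nat) (A : 'M[R]_(m, n)).

(** The eigenvalue count holds over the complex numbers; the eigenvalues of the
    real Gram matrix are nonnegative reals, hence squares of real numbers. *)
Lemma gram_roots r (M : R) (a : 'I_r -> 'I_m) (b : 'I_r -> 'I_n) :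
  0 < M -> (forall s, M <= `|A (a s) (b s)|) ->
  (forall s t, s != t -> A (a s) (b t) = 0) ->
  exists x : 'I_n -> R, [/\ forall i, 0 <= x i,
    char_poly (A^T *m A) = \prod_i ('X - (x i ^+ 2)%:P) &
    (#|[set i | (x i < M)%R]| + r <= n)%N].
Proof.
move=> M0 Ad A0.
pose f := real_complex R; pose B : 'M[R[i]]_(m, n) := map_mx f A.
have [P [D [Pu D0 SE]]] := gram_spectral B.
have D0' i : D 0 i = (complex.Re (D 0 i))%:C%C.
  by have := D0 i; case: (D 0 i) => u v; rewrite lecE /= => /andP[/eqP-> _].
have Re0 i : 0 <= complex.Re (D 0 i) by rewrite -lecR -D0'.
have Sreal : B^t* *m B = map_mx f (A^T *m A).
  rewrite map_mxM; congr (_ *m _); apply/matrixP => i j; rewrite !mxE.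
  by apply/eqP; rewrite eq_complex /= oppr0 !eqxx.
exists (fun i => Num.sqrt (complex.Re (D 0 i))); split.
- by move=> i; rewrite sqrtr_ge0.
- have inj : injective (map_poly f) by apply: map_poly_inj.
  apply: inj; rewrite map_char_poly -Sreal SE -invmx_unitary //.
  rewrite char_poly_similar ?unitarymx_unit //.
  rewrite char_poly_trig ?diag_mx_is_trig // rmorph_prod.
  apply: eq_bigr => i _; rewrite rmorphB /= map_polyX map_polyC /=.
  by rewrite mxE eqxx sqr_sqrtr // -D0'.
- have Bd s : f M <= `|B (a s) (b s)|.
    rewrite mxE normc_def /= expr0n /= addr0 sqrtr_sqr.
    by rewrite lecR.
  have B0 s t : s != t -> B (a s) (b t) = 0.
    by move=> /A0; rewrite mxE => ->.
  have fM0 : 0 < f M by rewrite ltcR.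
  have := gram_small_eigen fM0 Pu D0 SE Bd B0.
  suff -> : [set i | (D 0 i < (f M) ^+ 2)%R] =
    [set i | (Num.sqrt (complex.Re (D 0 i)) < M)%R].
    by [].
  apply/setP => i; rewrite !inE D0' -rmorphXn ltcR.
  rewrite -[in RHS](@ltr_pXn2r _ 2) ?nnegrE ?sqrtr_ge0 ?(ltW M0) //.
  by rewrite sqr_sqrtr ?Re0.
Qed.

(** The only fact about singular values that is used: a large diagonal
    submatrix of size r forces the r-th singular value to be large, whatever the
    other entries of the matrix are. *)
Lemma singular_value_ge r (M : R) (a : 'I_r -> 'I_m) (b : 'I_r -> 'I_n) :
  (0 < r)%N -> 0 < M -> (forall s, M <= `|A (a s) (b s)|) ->
  (forall s t, s != t -> A (a s) (b t) = 0) ->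
  M <= singular_value r A.
Proof.
move=> r0 M0 Ad A0; have [x [x0 cpE small]] := gram_roots M0 Ad A0.
pose s0 := sort >=%R [seq x i | i <- enum 'I_n].
have [s [srt pos cps]] : exists s, singular_value_seq A s.
  exists s0; split.
  - by apply: sort_sorted => y z; exact: le_total.
  - by rewrite all_sort; apply/allP => y /mapP[i _ ->].
  - rewrite cpE /s0 (perm_big [seq x i | i <- enum 'I_n]) /=.
      by rewrite big_map big_enum.
    by rewrite perm_sort.
rewrite /singular_value; case: xgetP => [s' _ |/(_ s)]; last by case.
move=> {s srt pos cps} [srt /allP pos cps].
(* Any sequence of singular values has the squares x i ^+ 2 as its squares, so
   it has at most n - r entries below M; being sorted, its r-th entry is not. *)
have pe : perm_eq [seq y ^+ 2 | y <- s'] [seq x i ^+ 2 | i <- enum 'I_n].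
  by apply: prod_XsubC_eq; rewrite 2!big_map -cps cpE [RHS]big_enum.
have szs : size s' = n.
  by move: (perm_size pe); rewrite 2!size_map size_enum_ord.
have cnt : count (fun y => y < M) s' = #|[set i | (x i < M)%R]|.
  rewrite cardsE cardE /enum_mem size_filter -enumT.
  have /permP/(_ (fun y => y < M ^+ 2)) := pe.
  rewrite !count_map => e.
  rewrite (_ : count _ s' = count (preim (fun i => i ^+ 2) (fun y => y < M ^+ 2)) s').
    rewrite e; apply: eq_count => i /=.
    by rewrite ltr_pXn2r ?nnegrE ?x0 // ltW.
  apply: eq_in_count => y ys /=.
  by rewrite ltr_pXn2r ?nnegrE ?(pos y) // ltW.
rewrite leNgt; apply/negP => lt.
have rn : (r <= n)%N by lia.
have : (n - r.-1 <= count (fun y : R => (y < M)%R) s')%N.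
  rewrite -(cat_take_drop r.-1 s') count_cat.
  have /eqP-> : count (fun y : R => (y < M)%R) (drop r.-1 s') == size (drop r.-1 s').
    rewrite -all_count.
    apply/(all_nthP (0 : R)) => i; rewrite size_drop szs => ii.
    rewrite nth_drop; apply: le_lt_trans lt.
    apply: (sorted_leq_nth _ _ _ srt) => //; rewrite ?inE ?szs; try lia.
      by move=> u v w uv vw; apply: le_trans vw uv.
    exact: lexx.
  by rewrite size_drop szs leq_addl.
rewrite cnt; lia.
Qed.

End SingularValue.

(** * Sequential unfoldings and mixed-radix expansions *)

Section MixedRadix.
Local Open Scope nat_scope.

Definition radix (b f : nat -> nat) n := \sum_(0 <= j < n) f j * \prod_(0 <= l < j) b l.

Lemma radix_recr b f n : radix b f n.+1 = radix b f n + f n * \prod_(0 <= l < n) b l.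
Proof. by rewrite /radix big_nat_recr. Qed.

Lemma radix_lt b f n : (forall j, j < n -> f j < b j) ->
  radix b f n < \prod_(0 <= l < n) b l.
Proof.
elim: n => [|n IH] fb; first by rewrite /radix !big_nil.
rewrite radix_recr big_nat_recr //=.
have := IH (fun j jn => fb j (ltnW jn)); have := fb n (ltnSn n).
move: (radix b f n) (\prod_(0 <= l < n) b l) (f n) (b n) => x P y z; nia.
Qed.

Lemma radix_inj b f g n : (forall j, j < n -> f j < b j) ->
  (forall j, j < n -> g j < b j) -> radix b f n = radix b g n ->
  forall j, j < n -> f j = g j.
Proof.
elim: n => [//|n IH] fb gb; rewrite !radix_recr => e.
have fb' j : j < n -> f j < b j by move=> /ltnW; apply: fb.
have gb' j : j < n -> g j < b j by move=> /ltnW; apply: gb.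
have := radix_lt fb'; have := radix_lt gb' => ltg ltf.
have P0 : 0 < \prod_(0 <= l < n) b l by apply: leq_ltn_trans ltf.
have e1 := congr1 (fun x => x %% (\prod_(0 <= l < n) b l)) e.
have e2 := congr1 (fun x => x %/ (\prod_(0 <= l < n) b l)) e.
rewrite /= ![radix _ _ n + _]addnC !modnMDl !modn_small // in e1.
rewrite /= ![radix _ _ n + _]addnC !divnMDl // !divn_small // in e2.
move=> j; rewrite ltnS leq_eqVlt => /orP[/eqP->|]; first by lia.
exact: IH.
Qed.

End MixedRadix.

Section Unfolding.
Variables (R : realType) (d : nat) (p : nat -> nat).

(** Indices of tensors are dependent functions; reading them as functions on nat
    (0 outside the range) avoids transporting ordinals when core positions are
    shifted or when two indices are spliced. *)
Definition digit (i : tidx d p) (j : nat) : nat :=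
  if insub j is Some j' then i j' : nat else 0%N.

Lemma digitE (i : tidx d p) (j : 'I_d) : digit i j = i j.
Proof. by rewrite /digit valK. Qed.

Lemma digit_lt (i : tidx d p) j : (j < d)%N -> (digit i j < p j.+1)%N.
Proof. by move=> jd; rewrite (digitE i (Ordinal jd)) (ltn_ord (i _)). Qed.

Lemma eq_tidx (i i' : tidx d p) :
  (forall j, (j < d)%N -> digit i j = digit i' j) -> i = i'.
Proof.
by move=> e; apply/ffunP => j; apply: val_inj; rewrite /= -!digitE e.
Qed.

Lemma unfold_rowE k (i : tidx d p) : (k <= d)%N ->
  unfold_row k i = radix (fun l => p l.+1) (digit i) k.
Proof.
move=> kd; rewrite /unfold_row /radix big_mkord.
rewrite (big_ord_widen _ (fun j => digit i j * \prod_(0 <= l < j) p l.+1)%N kd).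
by apply: eq_bigr => j _; rewrite digitE big_add1.
Qed.

Lemma unfold_colE k (i : tidx d p) : (k <= d)%N ->
  unfold_col k i = radix (fun l => p (l + k).+1) (fun j => digit i (j + k)) (d - k).
Proof.
move=> kd; rewrite /unfold_col /radix.
transitivity (\sum_(k <= j < d) digit i j * \prod_(k <= l < j) p l.+1)%N.
  rewrite big_geq_mkord; apply: eq_bigr => j _.
  by rewrite digitE big_add1.
rewrite -{1}[k]add0n big_addn; apply: eq_bigr => j _.
by congr (_ * _)%N; rewrite -{1}[k]add0n big_addn addnK.
Qed.

Lemma unfold_row_lt k (i : tidx d p) : (k <= d)%N ->
  (unfold_row k i < \prod_(1 <= l < k.+1) p l)%N.
Proof.
move=> kd; rewrite unfold_rowE // big_add1; apply: radix_lt => j jk.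
by apply: digit_lt; apply: leq_trans jk kd.
Qed.

Lemma unfold_col_lt k (i : tidx d p) : (k <= d)%N ->
  (unfold_col k i < \prod_(k.+1 <= l < d.+1) p l)%N.
Proof.
move=> kd; rewrite unfold_colE // big_add1 -{4}[k]add0n big_addn.
by apply: radix_lt => j jk; apply: digit_lt; lia.
Qed.

(** Row and column are the mixed-radix expansions of the first k digits and of
    the remaining ones. *)
Lemma unfold_inj k (i i' : tidx d p) : (k <= d)%N ->
  unfold_row k i = unfold_row k i' -> unfold_col k i = unfold_col k i' -> i = i'.
Proof.
move=> kd; rewrite !unfold_rowE // !unfold_colE // => er ec.
apply: eq_tidx => j jd; case: (ltnP j k) => jk.
  by apply: radix_inj er _ jk => l lk; apply: digit_lt; lia.
have lt_digit i0 l : (l < d - k)%N -> (digit i0 (l + k) < p (l + k).+1)%N.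
  by move=> lk; apply: digit_lt; lia.
have := radix_inj (lt_digit i) (lt_digit i') ec (j := j - k).
by rewrite subnK //; apply; lia.
Qed.

Lemma unfoldingE k (X : tensor R d p) (i : tidx d p) a b : (k <= d)%N ->
  unfold_row k i = val a -> unfold_col k i = val b -> unfolding k X a b = X i.
Proof.
move=> kd ra cb; rewrite mxE (big_pred1 i) // => i'.
apply/andP/eqP => [[/eqP r' /eqP c']|->]; last by rewrite ra cb.
by apply: (unfold_inj kd); rewrite ?r' ?c'.
Qed.

(** [mix s t] splices the first k digits of [u s] with the last digits of
    [v t]. Its row depends on s only and its column on t only, so the hypotheses
    exhibit a diagonal submatrix of the unfolding. *)
Lemma unfolding_sv_ge k r (X : tensor R d p) (M : R)
    (u v : 'I_r -> nat -> nat) (mix : 'I_r -> 'I_r -> tidx d p) :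
  (k <= d)%N -> (0 < r)%N -> 0 < M ->
  (forall s t j, (j < d)%N ->
     digit (mix s t) j = if (j < k)%N then u s j else v t j) ->
  (forall s, M <= `|X (mix s s)|) ->
  (forall s t, s != t -> X (mix s t) = 0) ->
  M <= singular_value r (unfolding k X).
Proof.
move=> kd r0 M0 mixE Xd X0.
pose a s := Ordinal (unfold_row_lt (mix s s) kd).
pose b s := Ordinal (unfold_col_lt (mix s s) kd).
have XE s t : unfolding k X (a s) (b t) = X (mix s t).
  apply: unfoldingE => //=.
    rewrite !unfold_rowE // /radix !big_mkord; apply: eq_bigr => j _.
    by rewrite !mixE ?(leq_trans (ltn_ord j) kd) // ltn_ord.
  rewrite !unfold_colE // /radix !big_mkord; apply: eq_bigr => j _.
  have jd : (j + k < d)%N by have := ltn_ord j; lia.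
  by rewrite !mixE // ltnNge leq_addl.
apply: (@singular_value_ge _ _ _ _ r M a b) => // [s|s t st].
  by rewrite XE.
by rewrite XE X0.
Qed.

End Unfolding.

(** * Uniform lattice noise *)

Section UniformLaw.
Context disp (T : measurableType disp) (R : realType) (Z : finType) (z0 : Z) (e : Z -> T).

Let card_inv_ge0 : 0 <= (#|Z|%:R : R)^-1.
Proof. by rewrite invr_ge0. Qed.

(** The law of [e z] for z uniform on a finite type; [z0] serves only as the
    default value of [nth]. *)
Definition uniform_law : set T -> \bar R :=
  mscale (NngNum card_inv_ge0)
    (msum (fun k => dirac (e (nth z0 (enum Z) k)) : {measure set T -> \bar R}) #|Z|).

HB.instance Definition _ := Measure.on uniform_law.

Let sum_enum (F : Z -> R) :
  \sum_(k < #|Z|) F (nth z0 (enum Z) k) = \sum_z F z.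
Proof.
rewrite -[RHS]big_enum (big_nth z0) big_mkord /=.
by rewrite -cardE.
Qed.

Lemma uniform_lawE (A : set T) :
  uniform_law A = ((#|Z|%:R)^-1 * \sum_z \1_A (e z))%:E.
Proof.
by rewrite /uniform_law /mscale /= /msum /dirac /= sumEFin -EFinM (sum_enum (fun z => \1_A (e z))).
Qed.

Let uniform_law_setT : uniform_law setT = 1%E.
Proof.
rewrite uniform_lawE; congr (_%:E).
under eq_bigr do rewrite indicT.
rewrite sumr_const mulVf // pnatr_eq0 -lt0n.
by apply/card_gt0P; exists z0.
Qed.

HB.instance Definition _ := Measure_isProbability.Build _ _ R uniform_law uniform_law_setT.

Let ge0_integral_uniform (f : T -> R) : measurable_fun setT f ->
  (forall x, 0 <= f x) ->
  (\int[uniform_law]_x (f x)%:E = ((#|Z|%:R)^-1 * \sum_z f (e z))%:E)%E.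
Proof.
move=> mf f0.
have /measurable_EFinP mf' := mf.
have f0' x : [set: T]%classic x -> (0 <= (f x)%:E)%E by rewrite lee_fin.
rewrite /uniform_law (ge0_integral_mscale _ measurableT _ mf' f0').
rewrite (ge0_integral_measure_sum _ measurableT f0' mf').
rewrite -(sum_enum (fun z => f (e z))) EFinM -sumEFin; congr (_ * _)%E.
apply: eq_bigr => k _; rewrite (integral_dirac _ measurableT mf') /=.
by rewrite diracT mul1e.
Qed.

Lemma expectation_uniform (f : T -> R) : measurable_fun setT f ->
  ('E_uniform_law[f] = ((#|Z|%:R)^-1 * \sum_z f (e z))%:E)%E.
Proof.
move=> mf; rewrite expectation.unlock integralE.
have -> : ((fun x => (f x)%:E)^\+ = fun x => ((f^\+)%R x)%:E)%E.
  by apply/funext => x; rewrite funeposE /funrpos /= EFin_max.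
have -> : ((fun x => (f x)%:E)^\- = fun x => ((f^\-)%R x)%:E)%E.
  by apply/funext => x; rewrite funenegE /funrneg /= EFin_max.
rewrite (ge0_integral_uniform (measurable_funrpos mf) (funrpos_ge0 f)).
rewrite (ge0_integral_uniform (measurable_funrneg mf) (funrneg_ge0 f)).
rewrite -EFinB -mulrBr -sumrB; congr (_ * _)%:E; apply: eq_bigr => z _.
by have := congr1 (fun g => g (e z)) (funrposBneg f).
Qed.

End UniformLaw.

(** Crude form of cosh x <= exp (x^2 / 2). For x^2 < 1/2 use exp y <= 1/(1 - y) at
    y = x and y = - x, and 1/(1 - x^2) <= 1 + 2 x^2; otherwise |x| <= 2 x^2. *)
Lemma expR_symm_le (R : realType) (x : R) :
  expR x + expR (- x) <= 2 * expR (2 * x ^+ 2).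
Proof.
have [x2|x2] := ltP (x ^+ 2) (1 / 2).
- have pos y : y ^+ 2 < 1 / 2 :> R -> 0 < 1 - y by move=> ?; nra.
  have inv y : y ^+ 2 < 1 / 2 :> R -> expR y <= (1 - y)^-1.
    move=> y2; rewrite -[y in expR y]opprK expRN lef_pV2 ?posrE ?expR_gt0 ?pos //.
    exact: expR_ge1Dx.
  have h1 := inv x x2; have h2 := inv (- x); rewrite sqrrN opprK in h2.
  have p1 := pos x x2; have := pos (- x); rewrite sqrrN opprK => /(_ x2) p2.
  have u0 : 0 < 1 - x ^+ 2 by nra.
  have e : (1 - x)^-1 + (1 + x)^-1 = 2 * (1 - x ^+ 2)^-1 by field; lra.
  apply: (le_trans (lerD h1 (h2 x2))); rewrite e ler_pM2l //.
  apply: (@le_trans _ _ (1 + 2 * x ^+ 2)); last exact: expR_ge1Dx.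
  rewrite -[leLHS]mul1r ler_pdivrMr //; nra.
- have le y : `|y| = `|x| -> expR y <= expR (2 * x ^+ 2).
    move=> yx; rewrite ler_expR; apply: (le_trans (ler_norm _)); rewrite yx.
    have := normr_ge0 x; have : `|x| ^+ 2 = x ^+ 2 by rewrite real_normK ?num_real.
    move: x2 => /[swap] <-; nra.
  have := lerD (le x erefl) (le (- x) (normrN x)); lra.
Qed.

Section ProductAverage.
Variables (R : numFieldType) (I V : finType).
Hypothesis V0 : (0 < #|V|)%N.

(** Independence of the coordinates of a uniform vector. *)
Lemma average_prod (F : I -> V -> R) :
  (#|{ffun I -> V}|%:R)^-1 * \sum_(z : {ffun I -> V}) \prod_i F i (z i) =
  \prod_i ((#|V|%:R)^-1 * \sum_v F i v).
Proof.
rewrite big_split /= prodr_const card_ffun natrX -exprVn; congr (_ * _).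
by rewrite bigA_distr_bigA.
Qed.

Lemma average1 : (#|V|%:R : R)^-1 * \sum_(v : V) 1 = 1.
Proof. by rewrite sumr_const mulVf // pnatr_eq0 -lt0n. Qed.

Lemma average_marginal (i : I) (g : V -> R) :
  (#|{ffun I -> V}|%:R)^-1 * \sum_(z : {ffun I -> V}) g (z i) =
  (#|V|%:R)^-1 * \sum_v g v.
Proof.
pose F j v := if j == i then g v else 1.
rewrite (eq_bigr (fun z : {ffun I -> V} => \prod_j F j (z j))); last first.
  move=> z _; rewrite (bigD1 i) //= big1 ?mulr1 /F ?eqxx // => j ji.
  by rewrite (negPf ji).
rewrite average_prod (bigD1 i) //= [X in _ * X]big1 ?mulr1 => [|j ji].
  by congr (_ * _); apply: eq_bigr => v _; rewrite /F eqxx.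
by rewrite -[RHS]average1; congr (_ * _); apply: eq_bigr => v _; rewrite /F (negPf ji).
Qed.

End ProductAverage.

Section TensorMeasurability.
Context (R : realType) (d : nat) (p : nat -> nat).
Local Notation T := (tensor R d p).
Local Open Scope classical_set_scope.

Lemma measurable_entry (i : tidx d p) : measurable_fun setT (fun X : T => X i).
Proof.
move=> _ B mB; rewrite setTI; apply: sub_sigma_algebra.
by exists i, B.
Qed.

Lemma measurable_tensor disp (U : measurableType disp) (f : U -> T) :
  (forall i, measurable_fun setT (fun x => f x i)) -> measurable_fun setT f.
Proof.
move=> mf; apply: (@measurability _ _ _ _ _ _ (@tensor_cylinders R d p)) => //.
move=> _ [_ [i [B [mB ->]]] <-].
by have := mf i measurableT B mB; rewrite !setTI.
Qed.

Lemma frobenius_sqrE (X : T) : frobenius_norm X ^+ 2 = \sum_i X i ^+ 2.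
Proof. by rewrite sqr_sqrtr // sumr_ge0 // => i _; rewrite sqr_ge0. Qed.

Lemma measurable_squared_error (f : T -> T) (X : T) : measurable_fun setT f ->
  measurable_fun setT (squared_error f X).
Proof.
move=> mf; rewrite (_ : squared_error f X =
    fun Z => \sum_i ((f (X + Z) : T) i - X i) ^+ 2); last first.
  apply/funext => Z; rewrite /squared_error frobenius_sqrE.
  by apply: eq_bigr => i _; rewrite !ffunE.
apply: measurable_sum => i; apply: measurable_funX; apply: measurable_funB => //.
apply: (measurableT_comp (measurable_entry i)); apply: (measurableT_comp mf).
apply: measurable_tensor => j.
rewrite (_ : (fun _ => _) = fun Z : T => X j + Z j); last first.
  by apply/funext => Z; rewrite ffunE.
by apply: measurable_funD => //; exact: measurable_entry.
Qed.

End TensorMeasurability.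

Section LatticeNoise.
Context (R : realType) (d : nat) (p : nat -> nat) (K : nat) (delta : R).
Local Notation T := (tensor R d p).
Local Notation V := 'I_(K.*2.+1).
Local Notation box := {ffun tidx d p -> V}.

(** The 2 K + 1 multiples of delta in the interval from - K delta to K delta. *)
Definition lattice_pt (v : V) : R := delta * (v%:R - K%:R).

Definition lattice_tensor (z : box) : T := [ffun i => lattice_pt (z i)].

(** Independent entries, each uniform on the lattice. The point of a lattice is
    that a lattice shift of the signal can be absorbed exactly by the noise, so
    that risks are compared by counting noise vectors. *)
Definition lattice_noise : probability T R :=
  uniform_law R ([ffun => ord0] : box) lattice_tensor.

Let cV : (0 < #|V|)%N. Proof. by rewrite card_ord. Qed.

Lemma lattice_noiseE (A : set T) :
  lattice_noise A = ((#|box|%:R)^-1 * \sum_z \1_A (lattice_tensor z))%:E.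
Proof. exact: uniform_lawE. Qed.

Lemma expectation_lattice (f : T -> R) : measurable_fun setT f ->
  ('E_lattice_noise[f] = ((#|box|%:R)^-1 * \sum_z f (lattice_tensor z))%:E)%E.
Proof. exact: expectation_uniform. Qed.

Lemma lattice_rev (v : V) : lattice_pt (rev_ord v) = - lattice_pt v.
Proof.
rewrite /lattice_pt /= subSS natrB; last by rewrite -ltnS.
have -> : (K.*2)%:R = K%:R + K%:R :> R by rewrite -addnn natrD.
ring.
Qed.

Lemma lattice_bound (v : V) : 0 <= delta -> `|lattice_pt v| <= delta * K%:R.
Proof.
move=> d0; rewrite /lattice_pt normrM ger0_norm //; apply: ler_wpM2l => //.
have : (v%:R : R) <= (K.*2)%:R by rewrite ler_nat -ltnS.
have -> : (K.*2)%:R = K%:R + K%:R :> R by rewrite -addnn natrD.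
rewrite ler_norml => h; have := ler0n R v; lra.
Qed.

Lemma lattice_independent :
  mutually_independent lattice_noise (fun (i : tidx d p) (Z : T) => Z i).
Proof.
move=> J B mB.
have marg i : lattice_noise ((fun Z : T => Z i) @^-1` B i)%classic =
    ((#|V|%:R)^-1 * \sum_v \1_(B i) (lattice_pt v))%:E.
  rewrite lattice_noiseE -(average_marginal cV i) //; congr (_ * _)%:E.
  apply: eq_bigr => z _; rewrite !indicE /=; congr ((nat_of_bool _)%:R).
  by apply/idP/idP; rewrite !in_setE /= ffunE.
under eq_bigr do rewrite marg.
rewrite lattice_noiseE prodEFin; congr (_%:E).
pose F i v := if i \in J then \1_(B i) (lattice_pt v) : R else 1.
rewrite [RHS](eq_bigr (fun i => (#|V|%:R)^-1 * \sum_v F i v)); last first.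
  by move=> i iJ; congr (_ * _); apply: eq_bigr => v _; rewrite /F iJ.
rewrite [RHS]big_mkcond [RHS](eq_bigr (fun i => (#|V|%:R)^-1 * \sum_v F i v)); last first.
  move=> i _; case: ifP => // iJ.
  by rewrite -[LHS](average1 R cV); congr (_ * _); apply: eq_bigr => v _; rewrite /F iJ.
rewrite -average_prod; congr (_ * _); apply: eq_bigr => z _.
rewrite indicE; case: (boolP [forall i in J, lattice_pt (z i) \in B i]).
  move=> /forall_inP h; rewrite big1 => [|i _].
    by rewrite mem_set // => i /= iJ; have := h i iJ; rewrite ffunE in_setE.
  by rewrite /F; case: ifP => // iJ; rewrite indicE h.
rewrite negb_forall_in => /exists_inP[i iJ ni].
rewrite memNset => [|/(_ i iJ)]; last by rewrite /= ffunE => /mem_set; apply/negP.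
by rewrite (bigD1 i) //= /F iJ indicE (negPf ni) mul0r.
Qed.

Lemma lattice_centered (i : tidx d p) :
  ('E_lattice_noise[(fun Z : T => Z i)] = 0)%E.
Proof.
rewrite expectation_lattice; last exact: measurable_entry.
under eq_bigr do rewrite ffunE.
rewrite (average_marginal cV i lattice_pt).
suff -> : \sum_v lattice_pt v = 0 by rewrite mulr0.
have : \sum_v lattice_pt v = - \sum_v lattice_pt v.
  rewrite -sumrN [LHS](reindex_inj rev_ord_inj) /=.
  by apply: eq_bigr => v _; rewrite lattice_rev.
lra.
Qed.

Lemma lattice_sub_gaussian sigma (i : tidx d p) :
  0 <= delta -> delta * K%:R <= sigma / 2 ->
  sub_gaussian lattice_noise sigma (fun Z : T => Z i).
Proof.
move=> d0 dK t; rewrite lattice_centered /=.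
rewrite expectation_lattice; last first.
  apply: (@measurableT_comp _ _ _ _ _ _ (@expR R) _ 
    (fun Z : T => t * (Z i - 0))); first exact: measurable_expR.
  apply: measurable_funM => //.
  by apply: measurable_funB => //; exact: measurable_entry.
under eq_bigr do rewrite ffunE subr0.
rewrite (average_marginal cV i (fun v => expR (t * lattice_pt v))).
rewrite lee_fin -[leRHS]mulr1 -[X in _ <= _ * X](average1 R cV) [leRHS]mulrCA.
rewrite ler_pM2l ?invr_gt0 ?ltr0n //.
rewrite mulr_sumr -(@ler_pM2l _ 2) // mulr_sumr.
rewrite [leLHS](_ : _ = \sum_v (expR (t * lattice_pt v) + expR (- (t * lattice_pt v)))).
  rewrite mulr_sumr; apply: ler_sum => v _; apply: (le_trans (expR_symm_le _)).
  rewrite mulr1 ler_pM2l // ler_expR.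
  have : lattice_pt v ^+ 2 <= (sigma / 2) ^+ 2.
    rewrite -[leLHS]real_normK ?num_real // lerXn2r ?nnegrE //.
      by apply: le_trans dK; rewrite mulr_ge0.
    exact: (le_trans (lattice_bound v d0)).
  have := sqr_ge0 t; rewrite !exprMn exprVn; nra.
rewrite big_split /= [X in _ + X](reindex_inj rev_ord_inj) /=.
under [X in _ + X]eq_bigr do rewrite lattice_rev mulrN opprK.
by rewrite -mulr_sumr; ring.
Qed.

(** The law is symmetric, and its amplitude delta K <= sigma / 2 makes up for the
    constant lost in [expR_symm_le]. *)
Lemma lattice_noise_class sigma : 0 <= delta -> delta * K%:R <= sigma / 2 ->
  noise_class sigma lattice_noise.
Proof.
move=> d0 dK; split; [exact: lattice_independent|exact: lattice_centered|].
by move=> i; exact: lattice_sub_gaussian.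
Qed.

End LatticeNoise.

(** * Assouad's method with lattice noise *)

Lemma sum_ltn n w : (\sum_(v < n) (v < w) = minn n w)%N.
Proof.
elim: n => [|n IH]; first by rewrite big_ord0 min0n.
by rewrite big_ord_recr /= IH; lia.
Qed.

(** Assouad's method for the family [X e], whose coordinate c moves X by
    +- delta W c. Flipping coordinate c is undone by the shift [shift c] of the
    noise, whenever the shifted noise stays in its box; the estimator then sees
    the same observation for two signals that differ by 2 delta H at entry
    [m c]. *)
Section Assouad.
Context (R : realType) (d : nat) (p : nat -> nat) (K H : nat) (delta : R).
Local Notation T := (tensor R d p).
Local Notation V := 'I_(K.*2.+1).
Local Notation box := {ffun tidx d p -> V}.
Context (C : finType) (W : C -> tidx d p -> nat) (m : C -> tidx d p).
Local Notation signs := {ffun C -> bool}.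
Context (X0 : T) (X : signs -> T).
Hypothesis XE : forall (e : signs) i,
  X e i = X0 i + delta * \sum_c (-1) ^+ e c * (W c i)%:R.
Hypothesis Wsum : forall c, (\sum_i (W c i).*2 <= K)%N.
Hypothesis Wm : forall c, W c (m c) = H.
Hypothesis m_inj : injective m.

Definition flip (c : C) (e : signs) : signs := [ffun c' => (c' == c) (+) e c'].

Lemma flipK c : involutive (flip c).
Proof. by move=> e; apply/ffunP => c'; rewrite !ffunE addbA addbb. Qed.

Lemma flip_shift c (e : signs) i : ~~ e c ->
  X (flip c e) i = X e i - delta * (W c i).*2%:R.
Proof.
move=> ec; rewrite !XE (bigD1 c) //= [in RHS](bigD1 c) //= ffunE eqxx (negPf ec).
rewrite (eq_bigr (fun c' => (-1) ^+ e c' * (W c' i)%:R)); last first.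
  by move=> c' /negPf nc; rewrite ffunE nc.
rewrite /= expr0 expr1 -muln2 natrM; ring.
Qed.

Definition shift (c : C) (z : box) : box := [ffun i => inord (z i + (W c i).*2)].

Definition shiftable (c : C) : {pred box} :=
  [pred z : box | [forall i, (z i + (W c i).*2 < K.*2.+1)%N]].

Lemma flip_obs c (e : signs) (z : box) : ~~ e c -> z \in shiftable c ->
  X e + lattice_tensor delta z = X (flip c e) + lattice_tensor delta (shift c z).
Proof.
move=> ec /forallP zs; apply/ffunP => i; rewrite !ffunE flip_shift //.
by rewrite /lattice_pt inordK // natrD; ring.
Qed.

Lemma shift_inj c : {in shiftable c &, injective (shift c)}.
Proof.
move=> z z' /forallP zs /forallP zs' e; apply/ffunP => i; apply: val_inj => /=.
have := congr1 (fun y : box => val (y i)) e.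
by rewrite /= !ffunE !inordK // => /addIn.
Qed.

Let cV : (0 < #|V|)%N. Proof. by rewrite card_ord. Qed.

(** A union bound: entry i of a uniform noise vector leaves the box with
    probability at most 2 W c i / (2 K + 1), and these add up to less than 1/2. *)
Lemma card_shiftable c : (#|box|%:R : R) / 2 <= #|shiftable c|%:R.
Proof.
have B0 : 0 < #|box|%:R :> R.
  by rewrite ltr0n; apply/card_gt0P; exists [ffun => ord0].
rewrite -ler_pdivlMl //.
pose bad i (v : V) : R := (K.*2.+1 <= v + (W c i).*2)%N%:R.
have -> : #|shiftable c|%:R = \sum_(z : box) (z \in shiftable c)%:R :> R.
  by rewrite -natr_sum -sum1_card big_mkcond.
have union (z : box) : 1 - \sum_i bad i (z i) <= (z \in shiftable c)%:R.
  case: (boolP (z \in shiftable c)) => [_|].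
    by rewrite lerBlDr lerDl sumr_ge0.
  rewrite negb_forall => /existsP[j]; rewrite -leqNgt => zj.
  by rewrite subr_le0 (bigD1 j) //= {1}/bad zj lerDl sumr_ge0.
have marg i : (#|box|%:R)^-1 * \sum_(z : box) bad i (z i) <= (W c i).*2%:R / K.*2.+1%:R.
  rewrite (average_marginal cV i (bad i)) mulrC card_ord.
  rewrite ler_pM2r ?invr_gt0 ?ltr0n // -natr_sum ler_nat.
  rewrite (reindex_inj rev_ord_inj) /=.
  rewrite (eq_bigr (fun v : V => (v < (W c i).*2)%N : nat)) ?sum_ltn ?geq_minr //.
  by move=> v _; congr (nat_of_bool _); have := ltn_ord v; lia.
apply: le_trans (_ : (#|box|%:R)^-1 * \sum_(z : box) (1 - \sum_i bad i (z i)) <= _); last first.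
  by rewrite ler_pM2l ?invr_gt0 //; apply: ler_sum => z _.
rewrite sumrB mulrBr sumr_const mulVf ?gt_eqF // exchange_big /= mulr_sumr.
have : \sum_i (#|box|%:R)^-1 * \sum_(z : box) bad i (z i) <= 2^-1.
  apply: le_trans (_ : \sum_i (W c i).*2%:R / K.*2.+1%:R <= _); first exact: ler_sum.
  rewrite -mulr_suml -natr_sum ler_pdivrMr ?ltr0n //.
  have : ((\sum_i (W c i).*2)%N%:R : R) <= K%:R by rewrite ler_nat.
  have -> : K.*2.+1%:R = K%:R + K%:R + 1 :> R by rewrite -addnn -natrD -[_.+1]addn1 natrD.
  by lra.
lra.
Qed.

Lemma card_flip c : (#|[pred e : signs | ~~ e c]|%:R : R) = #|signs|%:R / 2.
Proof.
have e : #|[pred e : signs | e c]| = #|[pred e : signs | ~~ e c]|.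
  rewrite -(fintype.card_image (can_inj (flipK c))); apply: eq_card => e.
  apply/fintype.imageP/idP => [[e' e'c ->]|]; rewrite !inE.
    by rewrite ffunE eqxx /= negbK; rewrite inE in e'c.
  by move=> ec; exists (flip c e); rewrite ?flipK // inE ffunE eqxx /=.
have := cardC [pred e : signs | e c]; rewrite e => <-.
have -> : #|[predC [pred e : signs | e c]]| = #|[pred e : signs | ~~ e c]| by [].
by rewrite natrD; lra.
Qed.

(** Pair (e, z) with (flip c e, shift c z): the estimate u is the same while the
    two values x and x' of the signal at [m c] satisfy x - x' = 2 delta H, and
    (u - x)^2 + (u - x')^2 >= (x - x')^2 / 2. *)
Lemma assouad_coordinate (f : T -> T) c :
  #|signs|%:R * #|box|%:R * ((delta * H%:R) ^+ 2 / 2) <=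
  \sum_(e : signs) \sum_(z : box) (f (X e + lattice_tensor delta z) (m c) - X e (m c)) ^+ 2.
Proof.
pose S (e : signs) (z : box) : R := (f (X e + lattice_tensor delta z) (m c) - X e (m c)) ^+ 2.
have S0 e z : 0 <= S e z by exact: sqr_ge0.
change (#|signs|%:R * #|box|%:R * ((delta * H%:R) ^+ 2 / 2) <=
  \sum_(e : signs) \sum_(z : box) S e z).
rewrite (bigID (fun e : signs => ~~ e c)) /=.
rewrite [X in _ + X](reindex_inj (can_inj (flipK c))) /=.
rewrite [X in _ + X](eq_bigl (fun e : signs => ~~ e c)); last first.
  by move=> e; rewrite ffunE eqxx /= negbK.
rewrite -big_split /=.
have pair (e : signs) : ~~ e c -> #|shiftable c|%:R * (2 * (delta * H%:R) ^+ 2) <=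
    \sum_(z : box) S e z + \sum_(z : box) S (flip c e) z.
  move=> ec; rewrite mulr_natl -sumr_const.
  apply: le_trans (_ : \sum_(z in shiftable c) S e z +
    \sum_(z in shiftable c) S (flip c e) (shift c z) <= _); last first.
    apply: lerD.
      by rewrite [leRHS](bigID (mem (shiftable c))) /= lerDl sumr_ge0.
    rewrite -(big_imset (S (flip c e)) (@shift_inj c)) /=.
    rewrite [leRHS](bigID (mem [set shift c z | z in shiftable c])) /= lerDl.
    by rewrite sumr_ge0.
  rewrite -big_split /=; apply: ler_sum => z zs.
  rewrite /S -(flip_obs ec zs) flip_shift // Wm.
  move: (f _ _) (X e _) => u x; rewrite -muln2 natrM.
  move: (H%:R : R) => h.
  rewrite -subr_ge0; set D := (X in 0 <= X).
  have -> : D = 2 * (u - x + delta * h) ^+ 2 by rewrite /D; ring.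
  by rewrite mulr_ge0 ?sqr_ge0.
apply: le_trans (_ : \sum_(e in [pred e : signs | ~~ e c])
    #|shiftable c|%:R * (2 * (delta * H%:R) ^+ 2) <= _); last first.
  by apply: ler_sum => e; exact: pair.
rewrite sumr_const -[leRHS]mulr_natl card_flip.
have := card_shiftable c; have := sqr_ge0 (delta * H%:R).
have : 0 <= #|signs|%:R :> R by [].
move: (#|signs|%:R) (#|box|%:R) (#|shiftable c|%:R) ((delta * H%:R) ^+ 2) => a b s y a0 y0 bs.
have := mulr_ge0 a0 y0 => ay; nra.
Qed.

(** The entries [m c] are distinct, so the losses at these entries add up. *)
Lemma assouad_total (f : T -> T) :
  #|signs|%:R * #|box|%:R * (#|C|%:R * ((delta * H%:R) ^+ 2 / 2)) <=
  \sum_(e : signs) \sum_(z : box) squared_error f (X e) (lattice_tensor delta z).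
Proof.
apply: le_trans (_ : \sum_c \sum_(e : signs) \sum_(z : box)
    (f (X e + lattice_tensor delta z) (m c) - X e (m c)) ^+ 2 <= _).
  apply: le_trans (_ : \sum_(c : C) #|signs|%:R * #|box|%:R * ((delta * H%:R) ^+ 2 / 2) <= _).
    by rewrite sumr_const -[leRHS]mulr_natl mulrCA.
  by apply: ler_sum => c _; exact: assouad_coordinate.
rewrite exchange_big /=; apply: ler_sum => e _.
rewrite exchange_big /=; apply: ler_sum => z _.
rewrite /squared_error frobenius_sqrE.
rewrite (eq_bigr (fun i => (f (X e + lattice_tensor delta z) i - X e i) ^+ 2)); last first.
  by move=> i _; rewrite !ffunE.
rewrite -(big_imset (fun i => (f (X e + lattice_tensor delta z) i - X e i) ^+ 2)) /=; last first.
  by move=> c c' _ _; apply: m_inj.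
rewrite [leRHS](bigID (mem [set m c | c in C])) /= lerDl sumr_ge0 // => i _.
exact: sqr_ge0.
Qed.

Lemma assouad (f : T -> T) : measurable_fun setT f ->
  exists e : signs, ((#|C|%:R * ((delta * H%:R) ^+ 2 / 2))%:E <=
    'E_(lattice_noise d p K delta)[squared_error f (X e)])%E.
Proof.
move=> mf; set b := _ * _; apply: contrapT => no.
have lt e : (#|box|%:R)^-1 * \sum_(z : box) squared_error f (X e) (lattice_tensor delta z) < b.
  rewrite ltNge; apply/negP => ge; apply: no; exists e.
  by rewrite expectation_lattice ?lee_fin //; exact: measurable_squared_error.
have B0 : 0 < #|box|%:R :> R.
  by rewrite ltr0n; apply/card_gt0P; exists [ffun => ord0].
have := assouad_total f; apply/negP; rewrite -ltNge -mulrA -/b.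
have -> : #|signs|%:R * (#|box|%:R * b) = \sum_(e : signs) #|box|%:R * b.
  by rewrite sumr_const -[RHS]mulr_natl.
apply: ltr_sum => [|e _]; last by rewrite -ltr_pdivrMl.
by apply/hasP; exists [ffun => false]; rewrite // mem_index_enum.
Qed.

End Assouad.

(** * Transitions between bond states *)

(** The supports of the fixed cores. A core with r k incoming states, r k.+1
    outgoing ones and p k.+1 slices allows the transition a -> b in slice j when
    b = j r k + a or a = j r k.+1 + b. In each slice this is a partial matching of
    the two state sets, and all slices together reach every state on both sides
    as soon as r k.+1 <= p k.+1 r k and r k <= p k.+1 r k.+1. Hence an index of
    the tensor determines the sequence of states from either end. *)
Section Edges.
Local Open Scope nat_scope.
Variables (d : nat) (p r : nat -> nat).

(** Every outgoing state b has exactly one up edge, by Euclidean division by r k. *)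
Definition up_edge k a j b := b == j * r k + a.

(** Every incoming state a has exactly one down edge. *)
Definition down_edge k a j b := a == j * r k.+1 + b.

Definition edge k a j b := up_edge k a j b || down_edge k a j b.

Lemma edge_det_right k a j b b' : a < r k -> b < r k.+1 -> b' < r k.+1 ->
  edge k a j b -> edge k a j b' -> b = b'.
Proof.
rewrite /edge /up_edge /down_edge.
by case: j => [|j] al bl bl' /orP[]/eqP e1 /orP[]/eqP e2; nia.
Qed.

Lemma edge_det_left k a a' j b : a < r k -> a' < r k -> b < r k.+1 ->
  edge k a j b -> edge k a' j b -> a = a'.
Proof.
rewrite /edge /up_edge /down_edge.
by case: j => [|j] al bl bl' /orP[]/eqP e1 /orP[]/eqP e2; nia.
Qed.

Definition bounded_states (g : nat -> nat) l l' := forall k, l <= k <= l' -> g k < r k.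

Lemma edges_det_right (f g g' : nat -> nat) l n :
  bounded_states g l n -> bounded_states g' l n ->
  (forall k, l <= k < n -> edge k (g k) (f k) (g k.+1)) ->
  (forall k, l <= k < n -> edge k (g' k) (f k) (g' k.+1)) ->
  g l = g' l -> forall k, l <= k <= n -> g k = g' k.
Proof.
move=> gb gb' ge ge' gl; elim=> [|k IH] /andP[lk kn].
  by move: lk gl; rewrite leqn0 => /eqP->.
move: lk; rewrite leq_eqVlt => /orP[/eqP<- //|lk].
have e : g k = g' k by apply: IH; lia.
apply: (@edge_det_right k (g k) (f k)).
- by apply: gb; lia.
- by apply: gb; lia.
- by apply: gb'; lia.
- by apply: ge; lia.
- by rewrite e; apply: ge'; lia.
Qed.

Lemma edges_det_left (f g g' : nat -> nat) l n :
  bounded_states g l n -> bounded_states g' l n ->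
  (forall k, l <= k < n -> edge k (g k) (f k) (g k.+1)) ->
  (forall k, l <= k < n -> edge k (g' k) (f k) (g' k.+1)) ->
  g n = g' n -> forall k, l <= k <= n -> g k = g' k.
Proof.
move=> gb gb' ge ge' gl k /andP[lk kn]; move: kn lk.
move: {2}(n - k) (leqnn (n - k)) => x; elim: x k => [|x IH] k xk kn lk.
  by have -> : k = n by lia.
have [->//|kn'] := eqVneq k n.
have e : g k.+1 = g' k.+1 by apply: IH; lia.
apply: (@edge_det_left k _ _ (f k) (g k.+1)).
- by apply: gb; lia.
- by apply: gb'; lia.
- by apply: gb; lia.
- by apply: ge; lia.
- by rewrite e; apply: ge'; lia.
Qed.

Lemma euclid_unique m j j' a a' : a < m -> a' < m ->
  j * m + a = j' * m + a' -> a = a' /\ j = j'.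
Proof.
move=> am am' e; have m0 : 0 < m by lia.
have := congr1 (modn^~ m) e; have := congr1 (divn^~ m) e.
by rewrite /= !modnMDl !divnMDl // !modn_small // !divn_small // !addn0.
Qed.

(** Going left along up edges, quotients are digits and remainders are states,
    so the final state determines all the digits. *)
Lemma up_paths_unique (f f' g g' : nat -> nat) l n :
  bounded_states g l n -> bounded_states g' l n ->
  (forall k, l <= k < n -> up_edge k (g k) (f k) (g k.+1)) ->
  (forall k, l <= k < n -> up_edge k (g' k) (f' k) (g' k.+1)) ->
  g n = g' n -> forall k, l <= k < n -> f k = f' k.
Proof.
move=> gb gb' ge ge' gl.
have step k : l <= k < n -> g k.+1 = g' k.+1 -> g k = g' k /\ f k = f' k.
  move=> kl; have := gb k; have := gb' k; have := ge k; have := ge' k.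
  rewrite /up_edge => /(_ kl)/eqP-> /(_ kl)/eqP->.
  have kl' : l <= k <= n by lia.
  by move=> /(_ kl') g'r /(_ kl') gr; apply: euclid_unique.
have G k : l <= k <= n -> g k = g' k.
  move=> /andP[lk kn]; move: kn lk.
  move: {2}(n - k) (leqnn (n - k)) => x; elim: x k => [|x IH] k xk kn lk.
    by have -> : k = n by lia.
  have [->//|kn'] := eqVneq k n.
  by have [] := step k _ (IH k.+1 _ _ _); lia.
by move=> k kl; have [] := step k kl (G k.+1 _); lia.
Qed.

Lemma down_paths_unique (f f' g g' : nat -> nat) l n :
  bounded_states g l n -> bounded_states g' l n ->
  (forall k, l <= k < n -> down_edge k (g k) (f k) (g k.+1)) ->
  (forall k, l <= k < n -> down_edge k (g' k) (f' k) (g' k.+1)) ->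
  g l = g' l -> forall k, l <= k < n -> f k = f' k.
Proof.
move=> gb gb' ge ge' gl.
have step k : l <= k < n -> g k = g' k -> g k.+1 = g' k.+1 /\ f k = f' k.
  move=> kl; have := gb k.+1; have := gb' k.+1; have := ge k; have := ge' k.
  rewrite /down_edge => /(_ kl)/eqP-> /(_ kl)/eqP->.
  have kl' : l <= k.+1 <= n by lia.
  by move=> /(_ kl') g'r /(_ kl') gr; apply: euclid_unique.
have G k : l <= k <= n -> g k = g' k.
  elim: k => [|k IH] /andP[lk kn].
    by move: lk gl; rewrite leqn0 => /eqP->.
  move: lk; rewrite leq_eqVlt => /orP[/eqP<- //|lk].
  by have [] := step k _ (IH _); lia.
by move=> k kl; have [] := step k kl (G k _); lia.
Qed.

Hypothesis r_gt0 : forall k, k <= d -> 0 < r k.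
Hypothesis r_up : forall k, k < d -> r k.+1 <= p k.+1 * r k.
Hypothesis r_down : forall k, k < d -> r k <= p k.+1 * r k.+1.

Lemma up_path_exists l s : l <= d -> s < r l ->
  exists f g : nat -> nat, [/\ g l = s, bounded_states g 0 l &
    forall k, k < l -> f k < p k.+1 /\ up_edge k (g k) (f k) (g k.+1)].
Proof.
elim: l s => [|l IH] s ld sr.
  exists (fun=> 0), (fun=> s); split => // k; rewrite leqn0 => /eqP-> //.
have r0 := r_gt0 (ltnW ld).
have [|f [g [gl gb fg]]] := IH (s %% r l) (ltnW ld); first by rewrite ltn_mod.
exists (fun k => if k == l then s %/ r l else f k).
exists (fun k => if k == l.+1 then s else g k); split.
- by rewrite eqxx.
- move=> k /= kl; case: eqP => [->//|/eqP nk]; apply: gb; lia.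
- move=> k kl; have kne : (k == l.+1) = false by lia.
  rewrite kne eqSS; case: eqP => [->|/eqP nk].
    rewrite gl /up_edge -divn_eq eqxx; split=> //.
    by rewrite ltn_divLR //; apply: leq_trans sr _; exact: r_up.
  by apply: fg; lia.
Qed.

Lemma down_path_exists l s : l <= d -> s < r l ->
  exists f g : nat -> nat, [/\ g l = s, bounded_states g l d &
    forall k, l <= k < d -> f k < p k.+1 /\ down_edge k (g k) (f k) (g k.+1)].
Proof.
move=> ld; have [n dE] : exists n, d = l + n by exists (d - l); lia.
elim: n l s ld dE => [|n IH] l s ld dE sr.
  exists (fun=> 0), (fun=> s); split => // k kl; last by lia.
  by have -> : k = l by lia.
have r0 : 0 < r l.+1 by apply: r_gt0; lia.
have [|||f [g [gl gb fg]]] := IH l.+1 (s %% r l.+1).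
- by lia.
- by lia.
- by rewrite ltn_mod.
exists (fun k => if k == l then s %/ r l.+1 else f k).
exists (fun k => if k == l then s else g k); split.
- by rewrite eqxx.
- move=> k /= kl; case: eqP => [->//|/eqP nk]; apply: gb; lia.
- move=> k kl; case: (eqVneq k l) => [->|nk].
    have -> : (l.+1 == l) = false by lia.
    rewrite gl /down_edge -divn_eq eqxx; split=> //.
    by rewrite ltn_divLR //; apply: leq_trans sr _; apply: r_down; lia.
  have -> : (k.+1 == l) = false by lia.
  by apply: fg; lia.
Qed.

End Edges.

(** * The family of tensor trains *)

Lemma tidx_exists d p (f : nat -> nat) : (forall k, (k < d)%N -> (f k < p k.+1)%N) ->
  exists i : tidx d p, forall k, (k < d)%N -> digit i k = f k.
Proof.
move=> fp.
exists ([ffun k : 'I_d => Ordinal (fp k (ltn_ord k))] : {dffun forall k : 'I_d, 'I_(p k.+1)}).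
by move=> k kd; rewrite (digitE _ (Ordinal kd)) ffunE.
Qed.

Section TensorTrain.
Context (R : realType) (d : nat) (p r : nat -> nat).

(** The bond indices alpha_0, ..., alpha_d form an index of a tensor with
    dimensions r 0, ..., r d, up to conversion; this makes [digit] available. *)
Definition bond_path := tidx d.+1 (fun k => r k.-1).

Lemma path_lt (al : bond_path) k : (k <= d)%N -> (digit al k < r k)%N.
Proof. by rewrite -ltnS => kd; have := digit_lt al kd. Qed.

Lemma path_bounded (al : bond_path) l n : (n <= d)%N -> bounded_states r (digit al) l n.
Proof. by move=> nd k /andP[_ kn]; apply: path_lt; apply: leq_trans kn nd. Qed.

Lemma bond_path_exists (g : nat -> nat) : bounded_states r g 0 d ->
  exists al : bond_path, forall k, (k <= d)%N -> digit al k = g k.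
Proof.
move=> gb; have [k kd|al alE] := @tidx_exists d.+1 (fun k => r k.-1) g.
  by apply: gb; rewrite /= -ltnS.
by exists al => k kd; apply: alE.
Qed.

Lemma eq_bond_path (al al' : bond_path) :
  (forall k, (k <= d)%N -> digit al k = digit al' k) -> al = al'.
Proof. by move=> e; apply: eq_tidx => k kd; apply: e; rewrite -ltnS. Qed.

Definition tt_tensor (g : nat -> nat -> nat -> nat -> R) : tensor R d p :=
  [ffun i => \sum_(al : bond_path)
     \prod_(k < d) g k (digit al k) (digit i k) (digit al k.+1)].

Lemma has_TT_tensor g : has_TT r (tt_tensor g).
Proof.
exists (fun (k : 'I_d) (a : 'I_(r k)) (j : 'I_(p k.+1)) (b : 'I_(r k.+1)) => g k a j b).
move=> i; rewrite ffunE; apply: eq_bigr => al _; apply: eq_bigr => k _.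
congr (g k _ _ _); last exact: (digitE al (lift ord0 k)).
  exact: (digitE al (widen_ord (leqnSn d) k)).
exact: digitE.
Qed.

End TensorTrain.

(** Tensors whose cores other than core q are fixed. Core q contains a large
    multiple of the transition pattern in its slices 2 j < p q.+1, which makes all
    singular values large, and free signs in its last slices. *)
Section Family.
Context (R : realType) (d : nat) (p r : nat -> nat) (q h : nat).

Local Notation T := (tensor R d p).
Local Notation path := (bond_path d r).
Local Notation slots := ('I_(r q) * 'I_(p q.+1)./2 * 'I_(r q.+1))%type.

(** The positions of the free entries of core q: all of its last (p q.+1)./2
    slices. *)
Definition slot (c : slots) : nat * nat * nat :=
  (val c.1.1, (p q.+1).-1 - c.1.2, val c.2)%N.

Lemma slot_inj : injective slot.
Proof.
move=> [[a j] b] [[a' j'] b'] [/val_inj-> ej /val_inj->]; congr (_, _, _).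
by apply: val_inj; have := ltn_ord j; have := ltn_ord j'; rewrite /= in ej *; lia.
Qed.

Hypothesis qd : (q < d)%N.

(** Where the rank drops on the way from an end of the tensor to core q, several
    partial paths lead to the same state, so that a free sign of core q shows up
    in several entries of the tensor. Weight h on the edges of one main path and
    weight 1 on the others concentrates the sign on a single entry. *)
Definition weight k a j b : nat :=
  if (k < q)%N then (if up_edge r k a j b then h else down_edge r k a j b)
  else (if down_edge r k a j b then h else up_edge r k a j b).

Definition main_edge k a j b : bool :=
  if (k < q)%N then up_edge r k a j b else down_edge r k a j b.

Lemma weight_main k a j b : main_edge k a j b -> weight k a j b = h.
Proof. by rewrite /main_edge /weight; case: ifP => _ ->. Qed.

Lemma weight_nmain k a j b : ~~ main_edge k a j b -> (weight k a j b <= 1)%N.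
Proof. by rewrite /main_edge /weight; case: ifP => _ /negPf->; apply: leq_b1. Qed.

Definition frame_weight (i : tidx d p) (al : path) : nat :=
  \prod_(k < d | val k != q) weight k (digit al k) (digit i k) (digit al k.+1).

Definition frame_core (Q : nat -> nat -> nat -> R) k a j b : R :=
  if k == q then Q a j b else (weight k a j b)%:R.

Lemma frame_tensorE Q (i : tidx d p) : tt_tensor d p r (frame_core Q) i =
  \sum_(al : path) (frame_weight i al)%:R * Q (digit al q) (digit i q) (digit al q.+1).
Proof.
rewrite ffunE; apply: eq_bigr => al _.
rewrite (bigD1 (Ordinal qd)) //= /frame_core eqxx mulrC; congr (_ * _).
rewrite /frame_weight natr_prod; apply: eq_bigr => k kq.
by rewrite ifN // -[q]/(val (Ordinal qd)).
Qed.

Definition slot_eq (a j b : nat) (c : nat * nat * nat) : bool := (a, j, b) == c.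

(** The derivative of the tensor entry i with respect to the entry c of core q. *)
Definition response (c : nat * nat * nat) (i : tidx d p) : nat :=
  \sum_(al : path) frame_weight i al *
     slot_eq (digit al q) (digit i q) (digit al q.+1) c.

Definition pattern a j b : bool := (2 * j < p q.+1)%N && edge r q a j b.

Definition signed_core (M delta : R) (e : {ffun slots -> bool}) a j b : R :=
  M * (pattern a j b)%:R +
  delta * \sum_c (-1) ^+ e c * (slot_eq a j b (slot c))%:R.

Definition signed_tensor (M delta : R) (e : {ffun slots -> bool}) : T :=
  tt_tensor d p r (frame_core (signed_core M delta e)).

Definition base_tensor (M : R) : T :=
  tt_tensor d p r (frame_core (fun a j b => M * (pattern a j b)%:R)).

Lemma signed_tensorE M delta e i : signed_tensor M delta e i =
  base_tensor M i + delta * \sum_c (-1) ^+ e c * (response (slot c) i)%:R.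
Proof.
rewrite /signed_tensor /base_tensor !frame_tensorE.
under eq_bigr do rewrite mulrDr.
rewrite big_split /=; congr (_ + _); rewrite mulr_sumr.
under eq_bigr do rewrite mulr_sumr mulr_sumr.
rewrite exchange_big /=; apply: eq_bigr => c _.
rewrite /response natr_sum !mulr_sumr; apply: eq_bigr => al _.
by rewrite natrM; ring.
Qed.

(** The slices 2 j < p q.+1 contain no free entry. *)
Lemma signed_tensor_low M delta e i : (2 * digit i q < p q.+1)%N ->
  signed_tensor M delta e i =
  M * (\sum_(al : path) frame_weight i al *
         edge r q (digit al q) (digit i q) (digit al q.+1))%:R.
Proof.
move=> low; rewrite /signed_tensor frame_tensorE natr_sum mulr_sumr.
apply: eq_bigr => al _; rewrite natrM /signed_core /pattern low big1 => [|c _].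
  by rewrite mulr0 addr0 mulrCA.
rewrite /slot_eq /slot; case: eqP => [[_ jE _]|]; last by rewrite mulr0.
by exfalso; have := ltn_ord c.1.2; move: low; rewrite jE /=; lia.
Qed.

Definition main_path (i : tidx d p) (al : path) (c : nat * nat * nat) : Prop :=
  (forall k, (k < d)%N -> k != q -> main_edge k (digit al k) (digit i k) (digit al k.+1)) /\
  slot_eq (digit al q) (digit i q) (digit al q.+1) c.

Hypothesis r_gt0 : forall k, (k <= d)%N -> (0 < r k)%N.
Hypothesis r_up : forall k, (k < d)%N -> (r k.+1 <= p k.+1 * r k)%N.
Hypothesis r_down : forall k, (k < d)%N -> (r k <= p k.+1 * r k.+1)%N.

Lemma main_path_exists a j b : (a < r q)%N -> (j < p q.+1)%N -> (b < r q.+1)%N ->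
  exists i al, main_path i al (a, j, b).
Proof.
move=> aq jp bq.
have [f [g [gq gb fg]]] := up_path_exists r_gt0 r_up (ltnW qd) aq.
have [f' [g' [gq' gb' fg']]] := down_path_exists r_gt0 r_down qd bq.
pose F k := if (k < q)%N then f k else if k == q then j else f' k.
pose G k := if (k <= q)%N then g k else g' k.
have [k kd|i iE] := @tidx_exists d p F.
  rewrite /F; case: (ltngtP k q) => [kq|kq|->//]; first by have [] := fg k kq.
  by have [] := fg' k; lia.
have [k kd|al alE] := @bond_path_exists d r G.
  by rewrite /G; case: (leqP k q) => kq; [apply: gb|apply: gb']; lia.
exists i, al; split; last first.
  by rewrite /slot_eq iE // !alE ?(ltnW qd) // /G /F leqnn ltnn eqxx gq gq'.
move=> k kd kq; rewrite /main_edge iE // !alE ?(ltnW kd) // /F /G.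
case: (ltngtP k q) kq => [kq _|kq _|-> /eqP//]; first by have [] := fg k kq.
by have [] := fg' k; lia.
Qed.

(** The hypotheses on the ranks force 1 < p q.+1, so a third of the slices is free. *)
Lemma card_slots :
  (2 * r q.+1 <= p q.+1 * r q)%N -> (2 * r q <= p q.+1 * r q.+1)%N ->
  (r q * p q.+1 * r q.+1 <= 3 * #|{: slots}|)%N.
Proof.
move=> q_up q_down; have p1 : (1 < p q.+1)%N.
  have := r_gt0 (ltnW qd); have := r_gt0 qd; move: q_up q_down.
  by case: (p q.+1) => [|[|//]]; lia.
rewrite !card_prod !card_ord.
have : (p q.+1 <= 3 * (p q.+1)./2)%N by lia.
move: (p q.+1) (_./2) (r q) (r q.+1) => x y a b xy.
rewrite [leqRHS](_ : _ = a * (3 * y) * b)%N; last by lia.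
by do 2 (apply: leq_mul => //).
Qed.

Hypothesis r0 : r 0%N = 1%N.

(** Main paths follow edges, and edges determine the states from either end. *)
Lemma main_path_inj (rd : r d = 1%N) i al al' c c' :
  main_path i al c -> main_path i al' c' -> c = c'.
Proof.
move=> mp mp'; have [m s] := mp; have [m' s'] := mp'.
have edge_main k a j b : main_edge k a j b -> edge r k a j b.
  by rewrite /main_edge /edge; case: ifP => _ ->; rewrite ?orbT.
have z0 : digit al 0 = digit al' 0.
  by have := path_lt al (leq0n d); have := path_lt al' (leq0n d); rewrite r0; lia.
have zd : digit al d = digit al' d.
  by have := path_lt al (leqnn d); have := path_lt al' (leqnn d); rewrite rd; lia.
move/eqP: s => <-; move/eqP: s' => <-; congr (_, _, _).
  apply: (@edges_det_right r (digit i) _ _ 0 q) => //; rewrite ?leqnn //.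
  - by apply: path_bounded; exact: ltnW.
  - by apply: path_bounded; exact: ltnW.
  - by move=> l lq; apply/edge_main/m; lia.
  - by move=> l lq; apply/edge_main/m'; lia.
apply: (@edges_det_left r (digit i) _ _ q.+1 d) => //; rewrite ?leqnn ?qd //.
- exact: path_bounded.
- exact: path_bounded.
- by move=> l lq; apply/edge_main/m; lia.
- by move=> l lq; apply/edge_main/m'; lia.
Qed.

Hypothesis h_gt0 : (0 < h)%N.

Lemma weight_le k a j b : (weight k a j b <= h)%N.
Proof.
rewrite /weight; case: ifP => _; case: ifP => _ //.
  exact: leq_trans (leq_b1 _) h_gt0.
exact: leq_trans (leq_b1 _) h_gt0.
Qed.

Lemma weight_gt0 k a j b : (0 < weight k a j b)%N = edge r k a j b.
Proof.
by rewrite /weight /edge; case: ifP => _; case: (up_edge _ _ _ _ _);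
  case: (down_edge _ _ _ _ _).
Qed.

Lemma frame_weight_gt0 i al : reflect
  (forall k, (k < d)%N -> k != q -> edge r k (digit al k) (digit i k) (digit al k.+1))
  (0 < frame_weight i al)%N.
Proof.
rewrite /frame_weight; apply: (iffP idP) => [w k kd kq|e].
  by move: w; rewrite (bigD1 (Ordinal kd)) //= muln_gt0 weight_gt0 => /andP[].
by rewrite prodn_cond_gt0 // => k kq; rewrite weight_gt0 e.
Qed.

(** The states left of core q are determined by the index from the left end, and
    those right of core q by the index and the state that leaves core q. *)
Lemma frame_eq i (al al' : path) : (0 < frame_weight i al)%N ->
  (0 < frame_weight i al')%N -> digit al q = digit al' q ->
  digit al q.+1 = digit al' q.+1 -> al = al'.
Proof.
move=> /frame_weight_gt0 e /frame_weight_gt0 e' eq eq1.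
have z0 : digit al 0 = digit al' 0.
  by have := path_lt al (leq0n d); have := path_lt al' (leq0n d); rewrite r0; lia.
apply: eq_bond_path => k kd; case: (leqP k q) => kq.
  apply: (@edges_det_right r (digit i) _ _ 0 q) => //.
  - by apply: path_bounded; exact: ltnW.
  - by apply: path_bounded; exact: ltnW.
  - by move=> l lq; apply: e; lia.
  - by move=> l lq; apply: e'; lia.
apply: (@edges_det_right r (digit i) _ _ q.+1 d) => //; rewrite ?kq ?kd //.
- exact: path_bounded.
- exact: path_bounded.
- by move=> l lq; apply: e; lia.
- by move=> l lq; apply: e'; lia.
Qed.

Lemma response_eq1 c i (al : path) : (0 < frame_weight i al)%N ->
  slot_eq (digit al q) (digit i q) (digit al q.+1) c ->
  response c i = frame_weight i al.
Proof.
move=> w s; rewrite /response (bigD1 al) //= s muln1 big1 ?addn0 // => al' ne.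
case: (posnP (frame_weight i al')) => [->//|w'].
case: (boolP (slot_eq _ _ _ _)) => s'; last by rewrite muln0.
case/eqP: ne; move: s s'; rewrite /slot_eq => /eqP<- /eqP[e1 e2].
exact: (frame_eq w' w).
Qed.

Lemma response_eq0 c i :
  (forall al : path, (0 < frame_weight i al)%N ->
    ~~ slot_eq (digit al q) (digit i q) (digit al q.+1) c) -> response c i = 0%N.
Proof.
move=> n; rewrite /response big1 // => al _.
by case: (posnP (frame_weight i al)) => [->//|/n/negPf->]; rewrite muln0.
Qed.

Lemma main_path_edges i al c : main_path i al c -> (0 < frame_weight i al)%N.
Proof.
move=> [m _]; apply/frame_weight_gt0 => k kd kq.
by have := m k kd kq; rewrite /main_edge /edge; case: ifP => _ ->; rewrite ?orbT.
Qed.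

Lemma response_main i al c : main_path i al c -> response c i = (h ^ d.-1)%N.
Proof.
move=> mp; have w := main_path_edges mp; have [m s] := mp.
rewrite (response_eq1 w s) /frame_weight.
rewrite (eq_bigr (fun=> h)); last by move=> k kq; rewrite weight_main // m.
rewrite prod_nat_const; congr (_ ^ _)%N.
rewrite (eq_card (_ : _ =i predC1 (Ordinal qd))); last by [].
by rewrite cardC1 card_ord.
Qed.

(** Only one path contributes to [response c i']. If all its edges were main, its
    digits would be those of i; so one of the d - 1 factors h is replaced by a
    weight at most 1. *)
Lemma response_off i al i' c : main_path i al c -> i' != i ->
  (h * response c i' <= h ^ d.-1)%N.
Proof.
move=> [m s] ne; case: (posnP (response c i')) => [->|]; first by rewrite muln0.
case: (pselect (exists al' : path, (0 < frame_weight i' al')%N &&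
    slot_eq (digit al' q) (digit i' q) (digit al' q.+1) c)); last first.
  move=> no; rewrite response_eq0 // => al' w; apply/negP => s'.
  by apply: no; exists al'; rewrite w.
case=> al' /andP[w s'] _; rewrite (response_eq1 w s') /frame_weight.
have [k0 k0q k0m] : exists2 k0 : 'I_d, val k0 != q &
    ~~ main_edge k0 (digit al' k0) (digit i' k0) (digit al' k0.+1).
  apply: contrapT => no; case/eqP: ne; apply: eq_tidx => k kd.
  have m' l : (l < d)%N -> l != q ->
      main_edge l (digit al' l) (digit i' l) (digit al' l.+1).
    move=> ld lq; apply: contrapT => /negP nm.
    by apply: no; exists (Ordinal ld).
  move: s s'; rewrite /slot_eq => /eqP<- /eqP[e1 e2 e3].
  case: (ltngtP k q) => kq; last by rewrite kq.
    apply: (@up_paths_unique r _ _ (digit al') (digit al) 0 q) => //.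
    - by apply: path_bounded; exact: ltnW.
    - by apply: path_bounded; exact: ltnW.
    - by move=> l /= lq; have := m' l; rewrite /main_edge lq; apply; lia.
    - by move=> l /= lq; have := m l; rewrite /main_edge lq; apply; lia.
  apply: (@down_paths_unique r _ _ (digit al') (digit al) q.+1 d) => //.
  - exact: path_bounded.
  - exact: path_bounded.
  - move=> l lq; have := m' l; rewrite /main_edge; have -> : (l < q)%N = false by lia.
    by apply; lia.
  - move=> l lq; have := m l; rewrite /main_edge; have -> : (l < q)%N = false by lia.
    by apply; lia.
  - by rewrite kq kd.
have -> : (h ^ d.-1 = \prod_(k < d | val k != q) h)%N.
  rewrite prod_nat_const; congr (_ ^ _)%N.
  rewrite (eq_card (_ : _ =i predC1 (Ordinal qd))); last by [].
  by rewrite cardC1 card_ord.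
rewrite (bigD1 k0) //= [X in (_ <= X)%N](bigD1 k0) //= mulnA; apply: leq_mul.
  by rewrite -[X in (_ <= X)%N]muln1 leq_mul2l weight_nmain // orbT.
by apply: leq_prod => k _; exact: weight_le.
Qed.

(** The main entry contributes 2 h^(d - 1), and all the others together at most as
    much, since there are at most h of them and each is smaller by a factor h. *)
Lemma response_sum c i al : main_path i al c -> (#|tidx d p| <= h)%N ->
  (\sum_i' (response c i').*2 <= 4 * h ^ d.-1)%N.
Proof.
move=> mp hN; rewrite (bigD1 i) //= (response_main mp).
have : (h * \sum_(i' | i' != i) (response c i').*2 <= h * (2 * h ^ d.-1))%N.
  rewrite big_distrr /=.
  apply: leq_trans (_ : \sum_(i' : tidx d p) (2 * h ^ d.-1) <= _)%N.
    rewrite [X in (_ <= X)%N](bigID (fun i' => i' != i)) /=.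
    apply: leq_trans (leq_addr _ _); apply: leq_sum => i' ne.
    by have := response_off mp ne; rewrite -muln2 mulnA; lia.
  by rewrite sum_nat_const leq_mul2r hN orbT.
rewrite leq_pmul2l //; move: (h ^ d.-1)%N (\sum_(i' | _) _)%N => H S; lia.
Qed.

Hypothesis rd : r d = 1%N.
Hypothesis q_up : (2 * r q.+1 <= p q.+1 * r q)%N.
Hypothesis q_down : (2 * r q <= p q.+1 * r q.+1)%N.

(** For each state s at level k, follow up edges from s to the left end and down
    edges from s to the right end. They cross core q in a slice 2 j < p q.+1,
    since j * r q < r q.+1, respectively j * r q.+1 < r q. Splicing the left half
    for s with the right half for t gives an index at which every path is forced
    to be in state s and in state t at level k, hence a zero entry unless s = t. *)
Lemma signed_tensor_sv M delta e k : 0 < M -> (k <= d)%N ->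
  M <= singular_value (r k) (unfolding k (signed_tensor M delta e)).
Proof.
move=> M0 kd.
have up (s : 'I_(r k)) := up_path_exists r_gt0 r_up kd (ltn_ord s).
have down (s : 'I_(r k)) := down_path_exists r_gt0 r_down kd (ltn_ord s).
have [u {}up] := fin_all_exists up; have [g {}up] := fin_all_exists up.
have [v {}down] := fin_all_exists down; have [g' {}down] := fin_all_exists down.
pose F st j := if (j < k)%N then u st.1 j else v st.2 j.
have mixP st : exists i : tidx d p, forall j, (j < d)%N -> digit i j = F st j.
  apply: tidx_exists => j jd; rewrite /F; case: (ltnP j k) => jk.
    by have [_ _ /(_ j jk)[]] := up st.1.
  by have [_ _ /(_ j)[]] := down st.2; rewrite ?jk.
have [mix mixE] := fin_all_exists mixP.
have low st : (2 * digit (mix st) q < p q.+1)%N.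
  rewrite mixE // /F; case: (ltnP q k) => qk.
    have [_ gb /(_ q qk)[_]] := up st.1; have := gb q.+1; rewrite /up_edge qk => /(_ isT) + /eqP.
    by move: q_up; move: (g _ _) (g _ _) => x y; nia.
  have [_ gb /(_ q)] := down st.2; rewrite qk qd => /(_ isT)[_].
  have := gb q; rewrite /down_edge qk (ltnW qd) => /(_ isT) + /eqP.
  by move: q_down; move: (g' _ _) (g' _ _) => x y; nia.
apply: (@unfolding_sv_ge _ _ _ k (r k) _ M u v (fun s t => mix (s, t))) => //.
- exact: r_gt0.
- by move=> s t j jd; rewrite mixE.
- move=> s; rewrite signed_tensor_low // ger0_norm ?mulr_ge0 ?(ltW M0) //.
  rewrite ler_peMr ?(ltW M0) // ler1n.
  have [gk gb ge] := up s; have [gk' gb' ge'] := down s.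
  have [j jd|al alE] := @bond_path_exists d r (fun j => if (j <= k)%N then g s j else g' s j).
    by case: (leqP j k) => jk; [apply: gb|apply: gb']; lia.
  have alg j : (j <= k)%N -> digit al j = g s j.
    by move=> jk; rewrite alE ?jk //; lia.
  have alg' j : (k <= j <= d)%N -> digit al j = g' s j.
    move=> jk; rewrite alE; last by lia.
    case: (leqP j k) => // jk'; have -> : j = k by lia.
    by rewrite gk gk'.
  have all j : (j < d)%N -> edge r j (digit al j) (digit (mix (s, s)) j) (digit al j.+1).
    move=> jd; rewrite mixE // /F /edge; case: (ltnP j k) => jk.
      by have [_ +] := ge j jk; rewrite /= !alg ?(ltnW jk) // => ->.
    have [|_ +] := ge' j; first by rewrite jk jd.
    by rewrite /= !alg' ?jk ?jd ?(ltnW jd) ?(leqW jk) // => ->; rewrite orbT.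
  rewrite (bigD1 al) //= all // muln1 addn_gt0; apply/orP; left.
  by apply/frame_weight_gt0 => j jd _; exact: all.
- move=> s t st; rewrite signed_tensor_low // big1 ?mulr0 // => al _.
  apply/eqP; rewrite muln_eq0 -leqn0 leqNgt; apply: contraT; rewrite negb_or negbK.
  move=> /andP[/frame_weight_gt0 w]; rewrite eqb0 negbK => wq.
  have all j : (j < d)%N -> edge r j (digit al j) (digit (mix (s, t)) j) (digit al j.+1).
    by move=> jd; case: (eqVneq j q) => [->//|jq]; exact: w.
  have [gk gb ge] := up s; have [gk' gb' ge'] := down t.
  have z0 : g s 0 = digit al 0.
    by have := path_lt al (leq0n d); have := gb 0 (leq0n k); rewrite r0; lia.
  have zd : g' t d = digit al d.
    have := path_lt al (leqnn d); have := gb' d; rewrite leqnn kd => /(_ isT).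
    by rewrite rd; lia.
  (* The digits force the state at level k from the left end and, below, from
     the right end. *)
  have ek : digit al k = s.
    rewrite -gk; apply: (@edges_det_right r (u s) _ _ 0 k) => //.
    - exact: path_bounded.
    - move=> j /= jk; have := all j; rewrite mixE ?/F ?jk; try lia.
      by apply; lia.
    - by move=> j /= jk; have [_] := ge j jk; rewrite /edge => ->.
    - by rewrite leq0n leqnn.
  have ek' : digit al k = t.
    rewrite -gk'; apply: (@edges_det_left r (v t) _ _ k d) => //.
    - exact: path_bounded.
    - move=> j jk; have := all j; rewrite mixE ?/F; last by lia.
      have -> : (j < k)%N = false by lia.
      by apply; lia.
    - by move=> j jk; have [_] := ge' j jk; rewrite /edge => ->; rewrite orbT.
    - by rewrite leqnn kd.
  by case/eqP: st; apply: val_inj; rewrite /= -ek -ek'.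
Qed.

End Family.

(** * The minimax lower bound *)

(** Assouad's bound for the family that perturbs core q. The lattice step delta
    is chosen so that delta H = sigma / 8 for the main response H = h^(d - 1), and
    K = 4 H leaves room for the shifts by 2 [response]. Each slot then costs
    (sigma / 8)^2 / 2 = sigma^2 / 128, and a third of the entries of core q are
    slots. *)
Lemma risk_ge_core (R : realType) (d : nat) (p r : nat -> nat)
    (lambda : nat -> R) (sigma : R) (q : nat) :
  (q < d)%N -> r 0%N = 1%N -> r d = 1%N ->
  (forall k, (k <= d)%N -> (0 < r k)%N) ->
  (forall k, (k < d)%N -> (r k.+1 <= p k.+1 * r k)%N) ->
  (forall k, (k < d)%N -> (r k <= p k.+1 * r k.+1)%N) ->
  (2 * r q.+1 <= p q.+1 * r q)%N -> (2 * r q <= p q.+1 * r q.+1)%N ->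
  0 < sigma ->
  ((384^-1 * sigma ^+ 2 * (p q.+1 * r q.+1 * r q)%:R)%:E
     <= @minimax_risk R d p r lambda sigma)%E.
Proof.
move=> qd r0 rd r_gt0 r_up r_down q_up q_down s0.
pose h := #|tidx d p|.+1; pose H := (h ^ d.-1)%N; pose K := (4 * H)%N.
have H0 : (0 < H)%N by rewrite expn_gt0.
pose delta : R := sigma / (8 * H%:R).
have HR : 0 < H%:R :> R by rewrite ltr0n.
have d0 : 0 <= delta by rewrite divr_ge0 ?(ltW s0) // mulr_ge0.
have dH : delta * H%:R = sigma / 8 by rewrite /delta; field; rewrite gt_eqF.
have dK : delta * K%:R <= sigma / 2 by rewrite /K natrM mulrCA dH; lra.
pose M : R := 1 + \sum_(k < d) `|lambda k|.
have M0 : 0 < M by rewrite ltr_pwDl // sumr_ge0.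
pose slots := ('I_(r q) * 'I_(p q.+1)./2 * 'I_(r q.+1))%type.
have slotP (c : slots) :
    exists i : tidx d p, exists al : bond_path d r, main_path q i al (slot c).
  rewrite /slot; apply: (main_path_exists qd r_gt0 r_up r_down).
  - exact: ltn_ord.
  - by have := ltn_ord c.1.2; lia.
  - exact: ltn_ord.
have [m mP] := fin_all_exists slotP.
have [al {}mP] := fin_all_exists mP.
have h0 : (0 < h)%N by [].
have Wsum (c : slots) : (\sum_(i : tidx d p) (response r q h (slot c) i).*2 <= K)%N.
  exact: (response_sum qd r0 h0 (mP c) (leqnSn _)).
have Wm (c : slots) : response r q h (slot c) (m c) = H.
  exact: (response_main qd r0 h0 (mP c)).
have m_inj : injective m.
  move=> c c' e; apply: (@slot_inj p r q); have mc := mP c; rewrite e in mc.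
  exact: (main_path_inj qd r0 rd mc (mP c')).
apply: le_ereal_inf_tmp => _ [f mf <-].
have [e He] := assouad (signed_tensorE h qd M delta) Wsum Wm m_inj mf.
apply: (le_trans (y := 'E_(lattice_noise d p K delta)[squared_error f (signed_tensor d h M delta e)])%E).
  apply: le_trans He; rewrite lee_fin dH.
  have := card_slots qd r_gt0 q_up q_down.
  rewrite -(ler_nat R) !natrM => cs; have := sqr_ge0 sigma; nra.
apply: ereal_sup_ubound; exists (signed_tensor d h M delta e).
  split; first exact: has_TT_tensor.
  move=> k /andP[k1 kd]; apply: le_trans (_ : M <= _).
    have kd' : (k < d)%N by lia.
    rewrite /M (bigD1 (Ordinal kd')) //= addrCA ler_wpDr ?ler_norm //.
    by rewrite addr_ge0 // sumr_ge0.
  by apply: signed_tensor_sv => //; lia.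
exists (lattice_noise d p K delta) => //.
exact: lattice_noise_class.
Qed.

Theorem theorem4p2 (R : realType) (d : nat) (hd : (2 <= d)%N) :
  exists C0 c : R, 0 < C0 /\ 0 < c /\
    forall (p r : nat -> nat) (lambda : nat -> R) (sigma : R),
      (forall k : nat, (1 <= k <= d)%N -> (0 < p k)%N) ->
      (forall k : nat, (1 <= k <= d.-1)%N -> (0 < r k)%N) ->
      r 0%N = 1%N -> r d = 1%N ->
      0 < sigma ->
      (forall k : nat, (1 <= k <= d)%N -> C0 <= (p k)%:R) ->
      (2 * r 1 <= p 1)%N ->
      (forall i : nat, (2 <= i <= d.-1)%N ->
        (2 * r i <= p i * r i.-1)%N /\ (2 * r i.-1 <= p i * r i)%N) ->
      (r d.-1 <= p d)%N ->
      (forall i : nat, (1 <= i <= d.-1)%N -> 0 < lambda i) ->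
      (d = 3%N -> (r 1 * r 2 <= p 1)%N) ->
      ((c * sigma ^+ 2 * \sum_(1 <= i < d.+1) (p i * r i * r i.-1)%:R)%:E
         <= @minimax_risk R d p r lambda sigma)%E.
Proof.
exists 1, (384 * d%:R)^-1; split => //; split.
  by rewrite invr_gt0 mulr_gt0 // ltr0n; lia.
move=> p r lambda sigma p0 rpos r0 rd s0 _ rp1 rp rpd _ _.
have r_gt0 k : (k <= d)%N -> (0 < r k)%N.
  move=> kd; have [->|k0] := eqVneq k 0%N; first by rewrite r0.
  have [->|k1] := eqVneq k d; first by rewrite rd.
  by apply: rpos; lia.
have r1 : (0 < r 1)%N by apply: r_gt0; lia.
have half q : (q < d.-1)%N ->
    (2 * r q.+1 <= p q.+1 * r q)%N /\ (2 * r q <= p q.+1 * r q.+1)%N.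
  case: q => [|q] qd; first by rewrite r0 muln1; split => //; nia.
  by have := rp q.+2; apply; lia.
have dS : d = d.-1.+1 by lia.
have r_up k : (k < d)%N -> (r k.+1 <= p k.+1 * r k)%N.
  move=> kd; have [e|k1] := eqVneq k d.-1.
    rewrite e -dS rd muln_gt0 p0 ?r_gt0 //; lia.
  by have [] := half k; lia.
have r_down k : (k < d)%N -> (r k <= p k.+1 * r k.+1)%N.
  move=> kd; have [e|k1] := eqVneq k d.-1; first by rewrite e -dS rd muln1.
  by have [] := half k; lia.
have coreP q qd := @risk_ge_core R d p r lambda sigma q qd r0 rd r_gt0 r_up r_down.
have low q : (q < d.-1)%N ->
    ((384^-1 * sigma ^+ 2 * (p q.+1 * r q.+1 * r q)%:R)%:E
     <= @minimax_risk R d p r lambda sigma)%E.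
  by move=> qd; have [h1 h2] := half q qd; apply: coreP => //; lia.
have term q : (q < d)%N ->
    ((384^-1 * sigma ^+ 2 * (p q.+1 * r q.+1 * r q)%:R)%:E
     <= @minimax_risk R d p r lambda sigma)%E.
  move=> qd; have [e|q1] := eqVneq q d.-1; last by apply: low; lia.
  have rl : (0 < r d.-1)%N by apply: r_gt0; lia.
  case: (leqP (2 * r d.-1) (p d)) => pd.
    by apply: coreP => //; rewrite e -dS rd; nia.
  (* Here p d < 2 r d.-1, and core d may have no free slice at all; but its size
     p d * r d.-1 is at most 2 * (r d.-1) ^ 2, which is at most the size of the
     previous core. *)
  apply: le_trans (low d.-2 _); last by lia.
  have [] := half d.-2; first by lia.
  have -> : d.-2.+1 = d.-1 by lia.
  move=> h1 _; rewrite lee_fin; apply: ler_wpM2l.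
    by rewrite mulr_ge0 ?sqr_ge0 // invr_ge0.
  rewrite ler_nat e -dS rd.
  by rewrite muln1; nia.
(* The risk bounds each of the d terms, hence their average. *)
move: (minimax_risk _ _ _ _) term => [x| |] term; [|by rewrite leey|].
  rewrite lee_fin big_add1 /= big_mkord invfM.
  have : \sum_(q < d) 384^-1 * sigma ^+ 2 * (p q.+1 * r q.+1 * r q)%:R <= \sum_(q < d) x.
    by apply: ler_sum => q _; have := term q (ltn_ord q); rewrite lee_fin.
  rewrite sumr_const card_ord -mulr_sumr -[leRHS]mulr_natl.
  have d0 : 0 < d%:R :> R by rewrite ltr0n; lia.
  rewrite -ler_pdivrMl // => h; apply: le_trans h.
  by rewrite le_eqVlt; apply/orP; left; apply/eqP; rewrite -!mulrA mulrCA.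
by have := term 0%N (ltnW hd).
Qed.
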